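(* Let $q:\Sigma\twoheadrightarrow G$ be a twist. If $A$ is a $D$-contractive C*-completion of $C_c(\Sigma;G)$ (i.e. the completion of $C_c(\Sigma;G)$ with respect to a $D$-contractive C*-norm), then the monomial semigroup $N:=\mathrm{cl}(N_c(\Sigma;G))$ is a summable Cartan semigroup in $A$ whose associated semi-Cartan subalgebra is the diagonal $B:=\mathrm{cl}(B_c(\Sigma;G))$ (closures in $A$).
   Context: **Twists.** A bisection of a groupoid $G$ is a set $O\subseteq G$ with $O^{-1}O\cup OO^{-1}\subseteq G^{(0)}$ ($G^{(0)}$ the unit space). A groupoid is étale when it carries a topology with a basis of open bisections closed under pointwise products and inverses. A $\mathbb{T}$-groupoid is a Hausdorff topological groupoid $\Sigma$ with a free continuous action of the circle group $\mathbb{T}$ such that $t(ef)=(te)f=e(tf)$ for $t\in\mathbb{T}$ and composable $(e,f)$. A twist is a continuous open groupoid homomorphism $q:\Sigma\twoheadrightarrow G$ from a $\mathbb{T}$-groupoid $\Sigma$ onto a locally compact Hausdorff étale groupoid $G$ with $q^{-1}(\{q(e)\})=\mathbb{T}e$ for all $e\in\Sigma$. **Function algebras.** $C(\Sigma;G)$ is the set of continuous $a:\Sigma\to\mathbb{C}$ with $a(te)=\overline{t}a(e)$ for all $t\in\mathbb{T},e\in\Sigma$, and $C_c(\Sigma;G)$ consists of those with compact closed support. $C_c(\Sigma;G)$ is a *-algebra with $a^*(e)=\overline{a(e^{-1})}$ and convolution $ab(e)=\sum_{g\in q(e)G}a(\sigma(g))b(\sigma(g)^{-1}e)$, where $q(e)G=\{q(e)h:h\in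 G\text{ with }q(e)h\text{ defined}\}$ and $\sigma:G\to\Sigma$ is any section of $q$. The diagonal map $D$ is $D(a)(e)=a(e)$ if $q(e)\in G^{(0)}$ and $0$ otherwise. A C*-norm (submultiplicative, $\|a^*a\|=\|a\|^2$) is $D$-contractive if $\|D(a)\|\le\|a\|$ for all $a\in C_c(\Sigma;G)$. Write $\mathrm{supp}^\circ(a)=\{e:a(e)\ne0\}$ and $\overline{\mathrm{supp}}(a)$ for its closure; $B_c(\Sigma;G)=\{a\in C_c(\Sigma;G):q(\mathrm{supp}^\circ(a))\subseteq G^{(0)}\}$ and $N_c(\Sigma;G)=\{a\in C(\Sigma;G):q(\overline{\mathrm{supp}}(a))\text{ is a compact bisection}\}$. **Cartan semigroups.** For $N\subseteq A$, $N_+:=\{n^*n:n\in N\}$ and $C^*(N)$ is the C*-subalgebra generated by $N$. An expectation is a contractive idempotent linear map $A\to A$. $N\subseteq A$ is a Cartan semigroup if: (1) $N$ is a norm-closed *-subsemigroup of $A$ with dense linear span; (2) $B:=C^*(N_+)$ is commutative and contained in $N$; (3) there is an expectation $E$ from $A$ onto $B$ with $E(n)n^*\in B$ for all $n\in N$. Then $B$ is called the associated semi-Cartan subalgebra. $N$ is summable if for all $m,n\in N$ with $m^*n,mn^*\in B$ we have $m+n\in N$. *)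

(* Defs.v *)
From HB Require Import structures.
From mathcomp Require Import all_boot all_order all_algebra.
From mathcomp Require Import complex.
From mathcomp Require Import all_classical all_reals topology normedtype.

Set Implicit Arguments.
Unset Strict Implicit.
Unset Printing Implicit Defensive.

Import Order.TTheory GRing.Theory Num.Theory.
Import numFieldNormedType.Exports.

Local Open Scope classical_set_scope.
Local Open Scope ring_scope.

(* The analytic structure of a numClosedFieldType is keyed on the coercion from
   that type, so it is not found on R[i] directly; it is found on cplx R. *)
Definition cplx (R : realType) : numClosedFieldType := R[i].

(* Small categories with all arrows invertible, described by their arrows only:
   objects are identified with identity arrows.  The operation gmul is total,
   but its values are specified only at pairs (g, h) with gsrc g = grng h. *)
HB.mixin Record isGroupoid G := {
  gsrc : G -> G ;
  grng : G -> G ;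
  gmul : G -> G -> G ;
  ginv : G -> G ;
  gsrc_src : forall g, gsrc (gsrc g) = gsrc g ;
  grng_src : forall g, grng (gsrc g) = gsrc g ;
  gsrc_rng : forall g, gsrc (grng g) = grng g ;
  grng_rng : forall g, grng (grng g) = grng g ;
  gsrc_mul : forall g h, gsrc g = grng h -> gsrc (gmul g h) = gsrc h ;
  grng_mul : forall g h, gsrc g = grng h -> grng (gmul g h) = grng g ;
  gmulA : forall g h k, gsrc g = grng h -> gsrc h = grng k ->
    gmul g (gmul h k) = gmul (gmul g h) k ;
  gmul_src : forall g, gmul g (gsrc g) = g ;
  gmul_rng : forall g, gmul (grng g) g = g ;
  gsrc_inv : forall g, gsrc (ginv g) = grng g ;
  grng_inv : forall g, grng (ginv g) = gsrc g ;
  gmulVg : forall g, gmul (ginv g) g = gsrc g ;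
  gmulgV : forall g, gmul g (ginv g) = grng g
}.

#[short(type="groupoidType")]
HB.structure Definition Groupoid := {G of isGroupoid G}.

(* No compatibility between the two structures is required here;
   see topological_groupoid and etale below. *)
#[short(type="spaceGroupoidType")]
HB.structure Definition SpaceGroupoid := {G of Topological G & isGroupoid G}.

Section Groupoids.
Context {G : groupoidType}.
Implicit Types (g h : G) (O P : set G).

Definition composable g h : Prop := gsrc g = grng h.

Definition units : set G := [set g | gsrc g = g].

Definition setgM O P : set G :=
  [set k | exists g h, [/\ O g, P h, composable g h & k = gmul g h]].

Definition setgV O : set G := ginv @` O.

Definition bisection O : Prop :=
  setgM (setgV O) O `|` setgM O (setgV O) `<=` units.

End Groupoids.

Definition topological_groupoid (G : spaceGroupoidType) : Prop :=
  continuous (@ginv G) /\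
  {within [set p : G * G | composable p.1 p.2],
    continuous (fun p : G * G => gmul p.1 p.2)}.

Definition etale (G : spaceGroupoidType) : Prop :=
  exists BB : set (set G),
    [/\ basis BB,
        forall O, BB O -> bisection O,
        forall O P, BB O -> BB P -> BB (setgM O P) &
        forall O, BB O -> BB (setgV O)].

(* The circle group is {t | `|t| = 1}: the values of act are specified there
   only. *)
Record T_groupoid (R : realType) (S : spaceGroupoidType)
    (act : cplx R -> S -> S) : Prop := TGroupoid {
  T_hausdorff : hausdorff_space S ;
  T_topological : topological_groupoid S ;
  T_act1 : forall e, act 1 e = e ;
  T_actM : forall (s t : cplx R) e, `|s| = 1 -> `|t| = 1 ->
    act (s * t) e = act s (act t e) ;
  T_free : forall (t : cplx R) e, `|t| = 1 -> act t e = e -> t = 1 ;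
  T_continuous : {within [set p : cplx R * S | `|p.1| = 1],
    continuous (fun p : cplx R * S => act p.1 p.2)} ;
  T_mul : forall (t : cplx R) e f, `|t| = 1 -> composable e f ->
    [/\ composable (act t e) f, act t (gmul e f) = gmul (act t e) f,
        composable e (act t f) & act t (gmul e f) = gmul e (act t f)]
}.

Record twist (R : realType) (S G : spaceGroupoidType)
    (act : cplx R -> S -> S) (q : S -> G) : Prop := Twist {
  twist_T_groupoid : T_groupoid act ;
  twist_locally_compact : locally_compact [set: G] ;
  twist_hausdorff : hausdorff_space G ;
  twist_etale : etale G ;
  twist_continuous : continuous q ;
  twist_open : forall U, open U -> open (q @` U) ;
  twist_onto : range q = [set: G] ;
  twist_morphism : forall e f, composable e f ->
    composable (q e) (q f) /\ q (gmul e f) = gmul (q e) (q f) ;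
  twist_fiber : forall e,
    q @^-1` [set q e] = [set act t e | t in [set t : cplx R | `|t| = 1]]
}.

Section FunctionAlgebras.
Context {R : realType} {S G : spaceGroupoidType}.
Variables (act : cplx R -> S -> S) (q : S -> G).
Implicit Types (a b : S -> cplx R).

Definition osupp a : set S := [set e | a e != 0].

Definition csupp a : set S := closure (osupp a).

Definition CSG : set (S -> cplx R) :=
  [set a | continuous a /\
           forall (t : cplx R) e, `|t| = 1 -> a (act t e) = t^* * a e].

Definition CcSG : set (S -> cplx R) :=
  [set a | CSG a /\ compact (csupp a)].

Definition BcSG : set (S -> cplx R) :=
  [set a | CcSG a /\ q @` osupp a `<=` units].

Definition NcSG : set (S -> cplx R) :=
  [set a | [/\ CSG a, compact (q @` csupp a) & bisection (q @` csupp a)]].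

Definition fstar a : S -> cplx R := fun e => (a (ginv e))^*.

(* For a, b in CcSG the sum has finitely many nonzero terms and does not depend
   on the section sigma of q. *)
Definition conv (sigma : G -> S) a b : S -> cplx R := fun e =>
  \sum_(g \in [set gmul (q e) h | h in [set h | composable (q e) h]])
    a (sigma g) * b (gmul (ginv (sigma g)) e).

Definition diag a : S -> cplx R := fun e => if q e \in units then a e else 0.

(* As for normedModType, norms take their values in the (nonnegative elements
   of the) field of scalars.  Values outside CcSG are irrelevant. *)
Record cstar_norm (sigma : G -> S) (nrm : (S -> cplx R) -> cplx R) : Prop :=
  CstarNorm {
  nrm_ge0 : forall a, CcSG a -> 0 <= nrm a ;
  nrm0_eq0 : forall a, CcSG a -> nrm a = 0 -> a = 0 ;
  nrmZ : forall (c : cplx R) a, CcSG a -> nrm (c *: a) = `|c| * nrm a ;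
  nrmD : forall a b, CcSG a -> CcSG b -> nrm (a + b) <= nrm a + nrm b ;
  nrmM : forall a b, CcSG a -> CcSG b ->
    nrm (conv sigma a b) <= nrm a * nrm b ;
  nrm_cstar : forall a, CcSG a -> nrm (conv sigma (fstar a) a) = nrm a ^+ 2
}.

Definition diag_contractive (nrm : (S -> cplx R) -> cplx R) : Prop :=
  forall a, CcSG a -> nrm (diag a) <= nrm a.

End FunctionAlgebras.

(* C*-algebras, not necessarily unital. *)
HB.mixin Record isCstarAlgebra (R : realType) A
    of CompleteNormedModule (cplx R) A := {
  amul : A -> A -> A ;
  astar : A -> A ;
  amulA : forall x y z, amul x (amul y z) = amul (amul x y) z ;
  amulDl : forall x y z, amul (x + y) z = amul x z + amul y z ;
  amulDr : forall x y z, amul x (y + z) = amul x y + amul x z ;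
  amulZl : forall (c : cplx R) x y, amul (c *: x) y = c *: amul x y ;
  amulZr : forall (c : cplx R) x y, amul x (c *: y) = c *: amul x y ;
  astarK : forall x, astar (astar x) = x ;
  astarD : forall x y, astar (x + y) = astar x + astar y ;
  astarZ : forall (c : cplx R) x, astar (c *: x) = c^* *: astar x ;
  astarM : forall x y, astar (amul x y) = amul (astar y) (astar x) ;
  anormM : forall x y : A, `|amul x y| <= `|x| * `|y| ;
  anorm_cstar : forall x : A, `|amul (astar x) x| = `|x| ^+ 2
}.

#[short(type="cstarAlgType")]
HB.structure Definition CstarAlgebra (R : realType) :=
  {A of isCstarAlgebra R A & CompleteNormedModule (cplx R) A}.

(* A is the completion of CcSG for nrm, iota being the canonical embedding; the
   values of iota outside CcSG are irrelevant. *)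
Record completion (R : realType) (S G : spaceGroupoidType)
    (act : cplx R -> S -> S) (q : S -> G) (sigma : G -> S)
    (nrm : (S -> cplx R) -> cplx R) (A : cstarAlgType R)
    (iota : (S -> cplx R) -> A) : Prop := Completion {
  iotaD : forall a b, CcSG act a -> CcSG act b ->
    iota (a + b) = iota a + iota b ;
  iotaZ : forall (c : cplx R) a, CcSG act a -> iota (c *: a) = c *: iota a ;
  iotaM : forall a b, CcSG act a -> CcSG act b ->
    iota (conv q sigma a b) = amul (iota a) (iota b) ;
  iota_star : forall a, CcSG act a -> iota (fstar a) = astar (iota a) ;
  iota_norm : forall a, CcSG act a -> `|iota a| = nrm a ;
  iota_dense : closure (iota @` CcSG act) = [set: A]
}.

Section CartanSemigroups.
Context {R : realType} {A : cstarAlgType R}.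
Implicit Types (N B V : set A).

Definition subspace_closed V : Prop :=
  V 0 /\ forall (c : cplx R) x y, V x -> V y -> V (c *: x + y).

Definition linear_span N : set A := smallest subspace_closed N.

Definition star_subsemigroup N : Prop :=
  (forall m n, N m -> N n -> N (amul m n)) /\ (forall n, N n -> N (astar n)).

Definition cstar_subalgebra B : Prop :=
  [/\ subspace_closed B, star_subsemigroup B & closed B].

Definition cstar_gen N : set A := smallest cstar_subalgebra N.

Definition positives N : set A := [set amul (astar n) n | n in N].

Definition semi_cartan N : set A := cstar_gen (positives N).

Definition expectation (E : {linear A -> A}) : Prop :=
  (forall a, E (E a) = E a) /\ (forall a, `|E a| <= `|a|).

Record cartan_semigroup N : Prop := CartanSemigroup {
  cartan_closed : closed N ;
  cartan_star_subsemigroup : star_subsemigroup N ;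
  cartan_dense : closure (linear_span N) = [set: A] ;
  cartan_commutative : forall a b, semi_cartan N a -> semi_cartan N b ->
    amul a b = amul b a ;
  cartan_sub : semi_cartan N `<=` N ;
  cartan_expectation : exists E : {linear A -> A},
    [/\ expectation E, range E = semi_cartan N &
        forall n, N n -> semi_cartan N (amul (E n) (astar n))]
}.

Definition summable_semigroup N : Prop := forall m n, N m -> N n ->
  semi_cartan N (amul (astar m) n) -> semi_cartan N (amul m (astar n)) ->
  N (m + n).

End CartanSemigroups.

(* Main.v *)
From HB Require Import structures.
From mathcomp Require Import all_boot all_order all_algebra.
From mathcomp Require Import complex ring lra.
From mathcomp Require Import all_classical all_reals topology normedtype.
From mathcomp Require Import sequences realfun.
Require Import Defs.

(** Everything is reduced to computations with functions by two facts about the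
    norm of [A]: it agrees with the supremum norm on functions supported on a
    bisection ([NcSG_norm_le_sup]), and it dominates the values of every
    compactly supported function ([CcSG_value_le_norm]).

    Both are first proved on [BcSG], which is the algebra of compactly supported
    functions on the units. This uses that the units are clopen in [G] and that
    the twist is topologically trivial over them ([phase_continuous], a
    consequence of the compactness of the circle), which gives a continuous
    functional calculus on [BcSG]. A real function with values in [[-1, 1]] is the
    imaginary part of a unitary; this bounds its norm by 2, and the C*-identity
    improves the resulting bound on [BcSG] to the supremum norm
    ([BcSG_norm_le1]). Conversely a function whose norm were smaller than one of
    its values would divide a bump function infinitely often
    ([BcSG_value_le_norm]). The C*-identity extends the upper bound to [NcSG], and
    [D]-contractivity extends the lower bound to [CcSG].

    The algebraic part consists of computations of supports. The convolution of a
    function supported on a bisection with any other has a single nonzero term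
    ([conv_one_term]), so it is continuous, products of elements of [NcSG] are in
    [NcSG], and [n^* n] and [D(n) n^*] are in [BcSG]; these statements pass to
    closures. Urysohn functions cut elements of [CcSG] into elements of [NcSG]
    ([CcSG_bisection_ind]), which gives density of the span. The expectation is
    the extension of [D] by continuity. That the elements [n^* n] generate all of
    [B] follows by polarization ([B_generated]).

    For summability, elements [x] and [y] of the completion are treated as
    functions through their approximations. If [x^* y] and [x y^*] are in [B], their
    values away from the units vanish, and the open supports of [x] and [y]
    together form a bisection ([nonvanishing_rng], [nonvanishing_src]). Truncating
    approximations to compact parts of these open supports ([soft_threshold],
    which changes them little by the supremum norm bound) gives elements of
    [NcSG] whose sums are again in [NcSG]. *)

Set Implicit Arguments.
Unset Strict Implicit.
Unset Printing Implicit Defensive.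

Import Order.TTheory GRing.Theory Num.Theory.
Import numFieldNormedType.Exports.

Local Open Scope classical_set_scope.
Local Open Scope ring_scope.

(** * Complex numbers and continuity *)

Section ComplexNumbers.
Context {R : realType}.
Implicit Types (x y : R) (z w : cplx R).

(** Order arguments take place in [R], since the order of [cplx R] is partial;
    [rC], [reC], [rabs] and, for elements of normed modules, [rnorm] translate
    between the two fields. *)
Definition rC x : cplx R := (x%:C)%C.
Definition reC z : R := complex.Re (z : R[i]).
Definition rabs z : R := reC `|z|.

Lemma rC0 : rC 0 = 0. Proof. by []. Qed.
Lemma rC1 : rC 1 = 1. Proof. by []. Qed.
Lemma rCD x y : rC (x + y) = rC x + rC y.
Proof. exact: (rmorphD (real_complex R)). Qed.
Lemma rCN x : rC (- x) = - rC x.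
Proof. exact: (rmorphN (real_complex R)). Qed.
Lemma rCM x y : rC (x * y) = rC x * rC y.
Proof. exact: (rmorphM (real_complex R)). Qed.
Lemma rCX x n : rC (x ^+ n) = rC x ^+ n.
Proof. exact: (rmorphXn (real_complex R)). Qed.
Lemma rC_le x y : (rC x <= rC y) = (x <= y).
Proof. exact: lecR. Qed.
Lemma rC_lt x y : (rC x < rC y) = (x < y).
Proof. exact: ltcR. Qed.
Lemma rC_inj : injective rC. Proof. by move=> x y []. Qed.
Lemma norm_rC x : `|rC x| = rC `|x|.
Proof. by rewrite normc_def /= expr0n /= addr0 sqrtr_sqr. Qed.
Lemma conj_rC x : (rC x)^* = rC x.
Proof. by apply/CrealP; apply/complex_realP; exists x. Qed.

Lemma ge0_rC z : 0 <= z -> z = rC (reC z).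
Proof.
by move=> z0; rewrite /rC /reC RRe_real // realE z0.
Qed.

Lemma rabsE z : `|z| = rC (rabs z).
Proof. exact: ge0_rC. Qed.

Lemma rC_continuous : continuous rC.
Proof.
move=> x; apply/cvgrPdist_lt => e e0.
have -> : e = rC (reC e) by apply/ge0_rC/ltW.
near=> y.
rewrite -rCN -rCD norm_rC rC_lt.
near: y.
have e0' : 0 < reC e by rewrite -rC_lt -ge0_rC // ltW.
by apply/nbhs_ballP; exists (reC e) => //= t; rewrite -ball_normE.
Unshelve. all: by end_near. Qed.

Lemma reC_continuous : continuous reC.
Proof.
move=> z; have FF := nbhs_filter (z : cplx R).
apply/(@cvgrPdist_lt _ R _ _ FF) => e e0.
near=> w.
have -> : reC z - reC w = reC (z - w).
  by case: (z) (w) => [? ?] [? ?].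
rewrite -rC_lt; apply: le_lt_trans (normc_ge_Re _) _.
near: w.
have e0' : 0 < rC e by rewrite -rC0 rC_lt.
by apply/(@nbhs_ballP (cplx R)); exists (rC e) => //= t; rewrite -ball_normE.
Unshelve. all: by end_near. Qed.

Lemma rabs_continuous : continuous rabs.
Proof.
move=> z; apply: (@continuous_comp _ _ _ (fun z => `|z|) reC).
  exact: norm_continuous.
exact: reC_continuous.
Qed.

(** The circle is the continuous image of a closed subset of a square. *)
Lemma circle_compact : compact [set z : cplx R | `|z| = 1].
Proof.
have -> : [set z : cplx R | `|z| = 1] =
    (fun p : R * R => rC p.1 + 'i * rC p.2) @`
     ([set p | p.1 ^+ 2 + p.2 ^+ 2 = 1] `&` (`[-1, 1] `*` `[-1, 1])).
  apply/seteqP; split => [z /= z1|z /= [[x y] [/= xy _] <-]].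
    have zz : (complex.Re z) ^+ 2 + (complex.Im z) ^+ 2 = 1.
      by apply: complexI; rewrite add_Re2_Im2 z1 expr1n.
    exists (complex.Re z, complex.Im z) => /=.
      split => //.
      have h (a b : R) : a ^+ 2 + b ^+ 2 = 1 -> -1 <= a <= 1.
        move=> ab; rewrite -ler_norml -(@ler_pXn2r _ 2) ?nnegrE //.
        by rewrite expr1n real_normK ?num_real// -ab lerDl sqr_ge0.
      split; rewrite /= in_itv /=; first exact: h zz.
      by apply: h; rewrite addrC; exact: zz.
    by rewrite -complexiE [RHS]complexE.
  rewrite -complexiE.
  have -> : rC x + 'i%C * rC y = (x +i* y)%C by rewrite [RHS]complexE.
  by rewrite normc_def /= xy sqrtr1.
apply: (@continuous_compact (R * R)%type (cplx R)).
  apply: continuous_subspaceT => p.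
  apply: (@cvgD (cplx R) (cplx R)).
    apply: (@continuous_comp _ _ _ fst rC); first exact: cvg_fst.
    exact: rC_continuous.
  apply: (@cvgM (cplx R)); first exact: cvg_cst.
  apply: (@continuous_comp _ _ _ snd rC); first exact: cvg_snd.
  exact: rC_continuous.
rewrite setIC; apply: compact_closedI; last first.
  have c : continuous (fun p : R * R => p.1 ^+ 2 + p.2 ^+ 2).
    move=> p; apply: (@cvgD R R).
      apply: (@continuous_comp _ _ _ fst (fun x => x ^+ 2)).
        exact: cvg_fst.
      exact: exprn_continuous.
    apply: (@continuous_comp _ _ _ snd (fun x => x ^+ 2)).
      exact: cvg_snd.
    exact: exprn_continuous.
  have /continuous_closedP cc := c.
  exact: (cc _ (@closed_eq R 1)).
apply: compact_setX; exact: segment_compact.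
Qed.

Lemma conj_continuous : continuous (fun z : cplx R => z^*).
Proof.
move=> z; have FF := nbhs_filter (z : cplx R).
apply/(@cvgrPdist_lt _ (cplx R) _ _ FF) => e e0.
near=> w.
rewrite -raddfB norm_conjC.
near: w.
by apply/(@nbhs_ballP (cplx R)); exists e => //= t; rewrite -ball_normE.
Unshelve. all: by end_near. Qed.

Section ContinuousFunctions.
Context {T : topologicalType}.
Implicit Types (f g : T -> cplx R) (h : T -> R).

Lemma ccontD f g : continuous f -> continuous g ->
  continuous (fun t => f t + g t).
Proof. by move=> a b t; apply: (@cvgD (cplx R) (cplx R)); [exact: a|exact: b]. Qed.

Lemma ccontM f g : continuous f -> continuous g ->
  continuous (fun t => f t * g t).
Proof. by move=> a b t; apply: (@cvgM (cplx R)); [exact: a|exact: b]. Qed.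

Lemma ccont_cst (z : cplx R) : continuous (fun _ : T => z).
Proof. by move=> t; exact: cvg_cst. Qed.

Lemma ccontJ f : continuous f -> continuous (fun t => (f t)^*).
Proof.
move=> a t; apply: (@continuous_comp _ _ _ f (fun z => z^*)); first exact: a.
exact: conj_continuous.
Qed.

Lemma cont_rabs f : continuous f -> continuous (fun t => rabs (f t)).
Proof.
move=> a t; apply: (@continuous_comp _ _ _ f rabs); first exact: a.
exact: rabs_continuous.
Qed.

Lemma cont_rC h : continuous h -> continuous (fun t => rC (h t)).
Proof.
move=> a t; apply: (@continuous_comp _ _ _ h rC); first exact: a.
exact: rC_continuous.
Qed.

Lemma rcontD (h k : T -> R) : continuous h -> continuous k ->
  continuous (fun t => h t + k t).
Proof. by move=> a b t; apply: (@cvgD R R); [exact: a|exact: b]. Qed.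

Lemma rcontN h : continuous h -> continuous (fun t => - h t).
Proof. by move=> a t; apply: (@cvgN R R); exact: a. Qed.

Lemma rcontM (h k : T -> R) : continuous h -> continuous k ->
  continuous (fun t => h t * k t).
Proof. by move=> a b t; apply: (@cvgM R); [exact: a|exact: b]. Qed.

Lemma rcont_max (h k : T -> R) : continuous h -> continuous k ->
  continuous (fun t => Num.max (h t) (k t)).
Proof. by move=> a b t; apply: continuous_max; [exact: a|exact: b]. Qed.

Lemma rcont_min (h k : T -> R) : continuous h -> continuous k ->
  continuous (fun t => Num.min (h t) (k t)).
Proof. by move=> a b t; apply: continuous_min; [exact: a|exact: b]. Qed.

Lemma rcont_cst (z : R) : continuous (fun _ : T => z).
Proof. by move=> t; exact: cvg_cst. Qed.

Lemma rcontV h : continuous h -> (forall t, h t != 0) ->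
  continuous (fun t => (h t)^-1).
Proof. by move=> a b t; apply: (@cvgV R); [exact: b|exact: a]. Qed.

Lemma rcont_sqrt h : continuous h -> continuous (fun t => Num.sqrt (h t)).
Proof.
move=> a t; apply: (@continuous_comp _ _ _ h Num.sqrt); first exact: a.
exact: sqrt_continuous.
Qed.

End ContinuousFunctions.
End ComplexNumbers.

(** * Groupoids and bisections *)

Section GroupoidTheory.
Context {G : groupoidType}.
Implicit Types (g h u : G) (O : set G).

Lemma units_src g : units (gsrc g). Proof. exact: gsrc_src. Qed.
Lemma units_rng g : units (grng g). Proof. exact: gsrc_rng. Qed.

Lemma rng_unit u : units u -> grng u = u.
Proof. by rewrite /units /= => <-; rewrite grng_src. Qed.

Lemma src_unit u : units u -> gsrc u = u. Proof. by []. Qed.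

Lemma ginv_unit u : units u -> ginv u = u.
Proof.
move=> uu; have := gmul_src (ginv u).
by rewrite gsrc_inv rng_unit // gmulVg => <-; exact: uu.
Qed.

Lemma composableVg g : composable (ginv g) g.
Proof. exact: gsrc_inv. Qed.

Lemma composablegV g : composable g (ginv g).
Proof. by rewrite /composable grng_inv. Qed.

Lemma gmulKg g h : composable g h -> gmul (ginv g) (gmul g h) = h.
Proof.
move=> gh; rewrite gmulA ?gsrc_inv // gmulVg.
by rewrite (gh : _ = _) gmul_rng.
Qed.

Lemma gmulVKg g h : grng g = grng h -> gmul g (gmul (ginv g) h) = h.
Proof.
by move=> gh; rewrite gmulA ?gsrc_inv ?grng_inv // gmulgV gh gmul_rng.
Qed.

Lemma ginv_uniq g h : composable g h -> units (gmul g h) -> h = ginv g.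
Proof.
move=> gh ugh; rewrite -[LHS](gmulKg gh).
by rewrite -(rng_unit ugh) grng_mul // -gsrc_inv gmul_src.
Qed.

Lemma ginvK g : ginv (ginv g) = g.
Proof.
symmetry; apply: ginv_uniq; first exact: composableVg.
by rewrite gmulVg; exact: units_src.
Qed.

Lemma idem_unit u : composable u u -> gmul u u = u -> units u.
Proof.
move=> cu uu; have := gmulKg cu; rewrite uu gmulVg.
by [].
Qed.

(** In a groupoid [g h^-1] is a unit only when [g = h], so bisections are the
    sets on which source and range are injective; this is the form in which
    bisections are used below. *)
Lemma bisectionP O : bisection O <->
  (forall g h, O g -> O h -> gsrc g = gsrc h -> g = h) /\
  (forall g h, O g -> O h -> grng g = grng h -> g = h).
Proof.
split=> [bO|[sO rO] k].
  split=> g h Og Oh gh.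
    apply: can_inj ginvK _ _ _; symmetry; apply: ginv_uniq.
      by rewrite /composable gh grng_inv.
    apply: bO; right; exists g, (ginv h); split=> //; first by exists h.
    by rewrite /composable gh grng_inv.
  rewrite -[g]ginvK; symmetry; apply: ginv_uniq.
    by rewrite /composable gsrc_inv.
  apply: bO; left; exists (ginv g), h; split=> //; first by exists g.
  by rewrite /composable gsrc_inv.
case=> -[g [h [Og Oh gh ->]]].
  case: Og gh => g' Og' <-; rewrite /composable gsrc_inv => /(rO _ _ Og' Oh) ->.
  by rewrite gmulVg; exact: units_src.
case: Oh gh => h' Oh' <-; rewrite /composable grng_inv => /(sO _ _ Og Oh') ->.
by rewrite gmulgV; exact: units_rng.
Qed.

Lemma sub_bisection O P : O `<=` P -> bisection P -> bisection O.
Proof.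
move=> OP /bisectionP[sP rP]; apply/bisectionP; split=> g h /OP Pg /OP Ph.
  exact: sP.
exact: rP.
Qed.

End GroupoidTheory.

(** * Algebra of twists *)

Section TwistAlgebra.
Context {R : realType} {S G : spaceGroupoidType}.
Context {act : cplx R -> S -> S} {q : S -> G}.
Hypothesis hq : twist act q.
Implicit Types (t : cplx R) (e f u v : S).

Let hT := twist_T_groupoid hq.

Lemma act1 e : act 1 e = e. Proof. exact: T_act1 hT e. Qed.

Lemma actM s t e : `|s| = 1 -> `|t| = 1 -> act (s * t) e = act s (act t e).
Proof. exact: (T_actM hT). Qed.

Lemma norm1J t : `|t| = 1 -> `|t^*| = 1.
Proof. by rewrite norm_conjC. Qed.

Lemma norm1K t : `|t| = 1 -> t^* * t = 1.
Proof. by move=> t1; rewrite mulrC -normCK t1 expr1n. Qed.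

Lemma norm1V t : `|t| = 1 -> t^-1 = t^*.
Proof.
move=> t1; have t0 : t != 0 by rewrite -normr_eq0 t1 oner_eq0.
by apply: (mulIf t0); rewrite mulVf // norm1K.
Qed.

Lemma actK t e : `|t| = 1 -> act t^* (act t e) = e.
Proof. by move=> t1; rewrite -actM ?norm1J // norm1K // act1. Qed.

Lemma src_act t e : `|t| = 1 -> gsrc (act t e) = gsrc e.
Proof.
move=> t1; have c : composable e (gsrc e) by rewrite /composable grng_src.
by have [-> _ _ _] := T_mul hT t1 c; rewrite grng_src.
Qed.

Lemma rng_act t e : `|t| = 1 -> grng (act t e) = grng e.
Proof.
move=> t1; have c : composable (grng e) e by rewrite /composable gsrc_rng.
by have [_ _ <- _] := T_mul hT t1 c; rewrite gsrc_rng.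
Qed.

Lemma act_mull t e f : `|t| = 1 -> composable e f ->
  gmul (act t e) f = act t (gmul e f).
Proof. by move=> t1 c; have [_ -> _ _] := T_mul hT t1 c. Qed.

Lemma act_mulr t e f : `|t| = 1 -> composable e f ->
  gmul e (act t f) = act t (gmul e f).
Proof. by move=> t1 c; have [_ _ _ ->] := T_mul hT t1 c. Qed.

Lemma act_inv t e : `|t| = 1 -> ginv (act t e) = act t^* (ginv e).
Proof.
move=> t1; symmetry; apply: ginv_uniq.
  by rewrite /composable rng_act ?norm1J // grng_inv src_act.
have c : composable (act t e) (ginv e).
  by rewrite /composable src_act // grng_inv.
rewrite act_mulr ?norm1J // act_mull //; last exact: composablegV.
by rewrite actK // gmulgV; exact: units_rng.
Qed.

Lemma q_act t e : `|t| = 1 -> q (act t e) = q e.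
Proof.
move=> t1; have := twist_fiber hq e.
by move/seteqP => [_]; apply; exists t.
Qed.

Lemma q_fiber e f : q e = q f -> exists2 t, `|t| = 1 & f = act t e.
Proof.
move=> ef; have /seteqP[/(_ f) + _] := twist_fiber hq e.
by rewrite /= -ef => /(_ erefl)[t t1 <-]; exists t.
Qed.

Lemma q_mul e f : composable e f -> q (gmul e f) = gmul (q e) (q f).
Proof. by move=> /(twist_morphism hq)[]. Qed.

Lemma q_composable e f : composable e f -> composable (q e) (q f).
Proof. by move=> /(twist_morphism hq)[]. Qed.

Lemma q_units u : units u -> units (q u).
Proof.
move=> uu; have cu : composable u u by rewrite /composable rng_unit // src_unit.
apply: idem_unit; first exact: q_composable.
by rewrite -q_mul // -[X in gmul _ X](src_unit uu) gmul_src.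
Qed.

Lemma q_src e : q (gsrc e) = gsrc (q e).
Proof.
have c : composable e (gsrc e) by rewrite /composable grng_src.
have := q_composable c; rewrite /composable rng_unit //.
by apply: q_units; exact: units_src.
Qed.

Lemma q_rng e : q (grng e) = grng (q e).
Proof.
have c : composable (grng e) e by rewrite /composable gsrc_rng.
have := q_composable c; rewrite /composable src_unit //.
by apply: q_units; exact: units_rng.
Qed.

Lemma q_inv e : q (ginv e) = ginv (q e).
Proof.
apply: ginv_uniq; first by apply: q_composable; exact: composablegV.
rewrite -q_mul; last exact: composablegV.
by rewrite gmulgV q_rng; exact: units_rng.
Qed.

(** [act] preserves sources, so the circle acts without moving a unit to another
    unit: [S] and [G] have the same units. *)
Lemma q_units_inj u v : units u -> units v -> q u = q v -> u = v.
Proof.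
move=> uu uv /q_fiber[t t1 vE].
by rewrite -(src_unit uv) vE src_act // src_unit.
Qed.

Lemma q_src_inj e f : gsrc (q e) = gsrc (q f) -> gsrc e = gsrc f.
Proof. by rewrite -!q_src; apply: q_units_inj; exact: units_src. Qed.

Lemma q_rng_inj e f : grng (q e) = grng (q f) -> grng e = grng f.
Proof. by rewrite -!q_rng; apply: q_units_inj; exact: units_rng. Qed.

Lemma q_surj g : exists e, q e = g.
Proof.
have : range q g by rewrite (twist_onto hq).
by case=> e _; exists e.
Qed.

(** Over the units the twist is trivial as a set: each element is a phase times
    its source. *)
Lemma q_unit_phase e : units (q e) -> exists2 t, `|t| = 1 & e = act t (gsrc e).
Proof. by move=> ue; apply: q_fiber; rewrite q_src src_unit. Qed.

End TwistAlgebra.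

(** * Topology of twists *)

Lemma hausdorff_separation (T : topologicalType) (x y : T) : hausdorff_space T ->
  x <> y -> exists U V, [/\ nbhs x U, nbhs y V & U `&` V = set0].
Proof.
move=> hT xy; have := contra_not (hT x y) xy.
move=> /existsNP[U] /existsNP[V] /not_implyP[Ux] /not_implyP[Vy] UV.
by exists U, V; split=> //; apply/eqP; apply/negP => /negP/set0P.
Qed.

Lemma nbhs_subset (T : topologicalType) (x : T) (P Q : set T) :
  P `<=` Q -> nbhs x P -> nbhs x Q.
Proof. exact: filterS. Qed.

Lemma cont_pair (T U V : topologicalType) (f : T -> U) (g : T -> V) x :
  {for x, continuous f} -> {for x, continuous g} ->
  {for x, continuous (fun y => (f y, g y))}.
Proof. by move=> cf cg; exact: cvg_pair. Qed.

Lemma cont_near_eq (T U : topologicalType) (f g : T -> U) x :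
  nbhs x [set y | f y = g y] -> {for x, continuous f} ->
  {for x, continuous g}.
Proof.
move=> fg cf V; rewrite -(nbhs_singleton fg) => /cf Vf.
by apply: filterS (filterI fg Vf) => y /= [<-].
Qed.

Lemma cont_fst (T U : topologicalType) : continuous (@fst T U).
Proof. by move=> x; exact: cvg_fst. Qed.

Lemma cont_snd (T U : topologicalType) : continuous (@snd T U).
Proof. by move=> x; exact: cvg_snd. Qed.

Section TwistTopology.
Context {R : realType} {S G : spaceGroupoidType}.
Context {act : cplx R -> S -> S} {q : S -> G}.
Hypothesis hq : twist act q.
Implicit Types (t : cplx R) (e f u v : S).

Let hT := twist_T_groupoid hq.

Lemma q_continuous : continuous q. Proof. exact: (twist_continuous hq). Qed.

Lemma q_open (U : set S) : open U -> open (q @` U).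
Proof. exact: (twist_open hq). Qed.

Lemma ginv_continuous : continuous (@ginv S).
Proof. by have [] := T_topological hT. Qed.

Lemma gmul_near e f (V : set S) : composable e f -> nbhs (gmul e f) V ->
  \forall p \near (e, f), composable p.1 p.2 -> V (gmul p.1 p.2).
Proof.
move=> c Vef; have [_ /subspace_continuousP m] := T_topological hT.
exact: (m (e, f) c V Vef).
Qed.

Lemma act_near t e (V : set S) : `|t| = 1 -> nbhs (act t e) V ->
  \forall p \near (t, e), `|p.1| = 1 -> V (act p.1 p.2).
Proof.
move=> t1 Vte; have /subspace_continuousP m := T_continuous hT.
exact: (m (t, e) t1 V Vte).
Qed.

Lemma gsrc_continuous : continuous (@gsrc S).
Proof.
move=> e V Ve.
have near_m := @gmul_near (ginv e) e V (composableVg e).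
rewrite gmulVg in near_m; have {}near_m := near_m Ve.
have c : (fun f => (ginv f, f)) @ e --> (ginv e, e).
  exact: (@cont_pair _ _ _ _ id e (@ginv_continuous e) cvg_id).
move: (c _ near_m); apply: (@nbhs_subset S e) => f /= /(_ (composableVg f)).
by rewrite gmulVg.
Qed.

Lemma grng_continuous : continuous (@grng S).
Proof.
move=> e V Ve; rewrite -gsrc_inv in Ve.
have c := @continuous_comp _ _ _ (@ginv S) (@gsrc S) e.
move: (c (@ginv_continuous e) (@gsrc_continuous _) V Ve); apply: (@nbhs_subset S e) => f /=.
by rewrite gsrc_inv.
Qed.

(** The last two conditions make source and range open maps near [g]. *)
Lemma etale_nbhs (g : G) (U : set G) : nbhs g U ->
  exists O, [/\ open O, bisection O, O g, O `<=` U &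
   open (setgM O (setgV O)) /\ open (setgM (setgV O) O)].
Proof.
have [BB [[BBo BBb] bis mul inv]] := twist_etale hq.
move=> /BBb[O [BO Og] OU]; exists O; split=> //.
- exact: BBo.
- exact: bis.
- by split; apply: BBo; apply: mul => //; exact: inv.
Qed.

(** [O^-1 O] is a basic open neighbourhood of each unit of [O] made of units. *)
Lemma units_open : open (@units G).
Proof.
rewrite openE => u uu.
have [O [_ bO Ou _ [_ oO]]] := @etale_nbhs u setT filterT.
apply: (@nbhs_subset G u (setgM (setgV O) O)).
  by move=> k Ok; apply: bO; left.
apply: open_nbhs_nbhs; split=> //; exists u, u; split=> //.
- by exists u => //; exact: ginv_unit.
- by rewrite /composable rng_unit // src_unit.
by rewrite -[X in gmul _ X](src_unit uu) gmul_src.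
Qed.

Definition over_units : set S := q @^-1` @units G.

Lemma over_units_open : open over_units.
Proof.
by have /continuousP := twist_continuous hq; apply; exact: units_open.
Qed.

(** [e] lies over a unit when [q (gsrc e) = q e], a closed condition as [G] is
    Hausdorff. *)
Lemma over_units_closed : closed over_units.
Proof.
rewrite -[X in closed X]setCK; apply: open_closedC; rewrite openE => e ne.
have {}ne : q (gsrc e) <> q e by rewrite (q_src hq).
have [U [V [Ue Ve UV]]] := hausdorff_separation (twist_hausdorff hq) ne.
have c1 : (q \o gsrc) @ e --> q (gsrc e).
  apply: (@continuous_comp _ _ _ (@gsrc S) q); first exact: gsrc_continuous.
  exact: q_continuous.
have c2 : q @ e --> q e by exact: q_continuous.
near=> f => /= uf.
have : (U `&` V) (q f); last by rewrite UV.
split; last by near: f; exact: c2.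
rewrite -[q f]src_unit // -(q_src hq).
by near: f; exact: c1.
Unshelve. all: by end_near. Qed.

(** The part of the twist over the units is clopen, so a function which is
    continuous there may be extended by zero. *)
Lemma over_units_cutoff_continuous (a : S -> cplx R) :
  (forall e, over_units e -> {for e, continuous a}) ->
  continuous (fun e => if q e \in units then a e else 0).
Proof.
move=> ca e; have [ue|ue] := pselect (over_units e).
  apply: (@cont_near_eq _ _ a); last exact: ca.
  have nc : nbhs e over_units by apply: open_nbhs_nbhs; split=> //; exact: over_units_open.
  by move: nc; apply: nbhs_subset => f uf /=; rewrite ifT // inE.
apply: (@cont_near_eq _ _ (fun=> 0)); last exact: cvg_cst.
have nc : nbhs e (~` over_units).
  by apply: open_nbhs_nbhs; split=> //; exact/closed_openC/over_units_closed.
move: nc; apply: nbhs_subset => f uf /=.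
by rewrite ifF //; apply/negbTE; rewrite notin_setE.
Qed.

Definition phase e : cplx R := xget 1 [set t | `|t| = 1 /\ e = act t (gsrc e)].

Lemma phaseP e : over_units e -> `|phase e| = 1 /\ e = act (phase e) (gsrc e).
Proof.
move=> /(q_unit_phase hq)[t t1 et].
by apply: (@xgetPex _ 1 [set s | `|s| = 1 /\ e = act s (gsrc e)]); exists t.
Qed.

Lemma act_inj e (s t : cplx R) : `|s| = 1 -> `|t| = 1 -> act s e = act t e -> s = t.
Proof.
move=> s1 t1 st; have : t^* * s = 1.
  apply: (@T_free _ _ _ hT _ e); first by rewrite normrM norm1J // s1 mulr1.
  by rewrite (actM hq) ?norm1J // st (actK hq).
have t0 : t != 0 by rewrite -normr_eq0 t1 oner_eq0.
by rewrite -(norm1V t1) => /(canRL (mulKf (invr_neq0 t0))); rewrite invrK mulr1.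
Qed.

Lemma phase_act t u : `|t| = 1 -> units u -> phase (act t u) = t.
Proof.
move=> t1 uu; have ov : over_units (act t u).
  by rewrite /over_units /= (q_act hq) //; exact: (q_units hq).
have [p1] := phaseP ov; rewrite (src_act hq) // src_unit // => /esym.
exact: act_inj.
Qed.

(** [phase] is the first component of the inverse of the continuous bijection
    [(t, u) |-> act t u]. If [t] is not the phase of [e], then [act t (gsrc e)]
    and [e] have disjoint neighbourhoods; finitely many [t] suffice, by
    compactness of the circle. *)
Lemma phase_continuous e : over_units e -> phase @ e --> phase e.
Proof.
move=> ue W We.
have FF := nbhs_filter e.
have /compact_near_coveringP cov := @circle_compact R.
have := cov S (nbhs e) (fun f t => `|t| = 1 -> f = act t (gsrc f) -> W t) FF.
have hyp : forall t, `|t| = 1 -> \forall t' \near t & f \near e,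
    `|t'| = 1 -> f = act t' (gsrc f) -> W t'.
  move=> t t1; have [p1 pE] := phaseP ue.
  have [tE|tN] := pselect (t = phase e).
    rewrite -tE in We; exists (W, setT); first by split => //=; exact: filterT.
    by move=> [t' f] /= [].
  have ne : act t (gsrc e) <> e.
    by move=> te; apply: tN; apply: (@act_inj (gsrc e)) => //; rewrite te -pE.
  have [U [V [Ue Ve UV]]] := hausdorff_separation (T_hausdorff hT) ne.
  have near1 := act_near t1 Ue.
  have cs : {for (t, e), continuous (fun p : cplx R * S => gsrc p.2)}.
    apply: (@continuous_comp _ _ _ snd (@gsrc S)); first exact: cont_snd.
    exact: gsrc_continuous.
  have c := cont_pair (@cont_fst (cplx R) S (t, e)) cs.
  have near2 := c _ near1.
  have near3 : \forall p \near (t, e), V p.2.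
    by apply: (@cvg_snd _ _ (nbhs t) (nbhs e)).
  have : \forall p \near (t, e), `|p.1| = 1 -> p.2 = act p.1 (gsrc p.2) -> W p.1.
    near=> p => p11 pE'; exfalso.
    have : (U `&` V) p.2; last by rewrite UV.
    split; last by near: p.
    by rewrite pE'; move: p11; near: p.
  by [].
move=> /(_ hyp) covn.
have nu : nbhs e over_units by apply: open_nbhs_nbhs; split=> //; exact: over_units_open.
suff : \forall f \near e, W (phase f) by [].
near=> f.
have [uf1 uf2] : `|phase f| = 1 /\ f = act (phase f) (gsrc f).
  by apply: phaseP; near: f.
suff : [set z : cplx R | `|z| = 1] `<=` (fun t => `|t| = 1 -> f = act t (gsrc f) -> W t).
  by move=> /(_ (phase f) uf1 uf1 uf2).
by near: f.
Unshelve. all: by end_near. Qed.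

(** The fibers of the open map [q] are orbits of the compact circle. A cover of
    the fiber over [g] is, by compactness, uniform along the orbit, hence also
    covers the fibers over the open image under [q] of a neighbourhood. *)
Lemma q_proper (K : set G) : compact K -> compact (q @^-1` K).
Proof.
move=> /compact_near_coveringP covK; apply/compact_near_coveringP => I F P FF hP.
have : \near F, K `<=` (fun i g => forall e, q e = g -> P i e) F.
  apply: covK => g Kg; have [e qe] := q_surj hq g.
  have /compact_near_coveringP covT := @circle_compact R.
  have := covT (S * I)%type (filter_prod (nbhs e) F)
    (fun p t => `|t| = 1 -> P p.2 (act t p.1)) _.
  have hyp : forall t, `|t| = 1 -> \forall t' \near t & p \near filter_prod (nbhs e) F,
      `|t'| = 1 -> P p.2 (act t' p.1).
    move=> t t1; have := hP (act t e); rewrite /= (q_act hq) // qe => /(_ Kg).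
    case=> -[U V] /= [Ute FV] UV.
    have [[A B] /= [At Be] AB] := act_near t1 Ute.
    exists (A, B `*` V); first by split=> //=; exists (B, V).
    move=> [t' [e' i]] /= [At' [Be' Vi]] t'1.
    by apply: (UV (_, _)); split=> //=; exact: (AB (_, _)).
  move=> /(_ (filter_prod_filter (nbhs_filter e) FF) hyp)[[U V] /= [Ue FV] UV].
  exists (q @` U, V); first split => //=.
    have [W [oW We] WU] : exists2 W, open_nbhs e W & W `<=` U.
      by move: Ue; rewrite nbhsE => -[W [? ?] ?]; exists W.
    rewrite -qe; apply: (@filterS _ _ _ (q @` W)).
      by move=> _ [x Wx <-]; exists x => //; exact: WU.
    by apply: open_nbhs_nbhs; split; [exact: q_open|exists e].
  move=> [_ i] /= [[e' Ue' <-] Vi] e'' /esym/(q_fiber hq)[t t1 ->].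
  exact: (UV (e', i) _ t).
apply: filterS => i /= KP e; rewrite /= => Kqe; exact: (KP _ Kqe).
Qed.

(** The range map of [S] is open: [q] is open, and the range map of [G] sends
    a basic open bisection [O] to the open set [O O^-1]. *)
Lemma rng_lift_near (f0 e0 : S) (U : set S) : grng f0 = grng e0 -> nbhs f0 U ->
  \forall e \near e0, exists2 f, U f & grng f = grng e.
Proof.
move=> fe; rewrite nbhsE => -[W [oW Wf0] WU].
have nW : nbhs (q f0) (q @` W).
  by apply: open_nbhs_nbhs; split; [exact: q_open|exists f0].
have [O [_ bO Of0 OW [oO _]]] := etale_nbhs nW.
have nO : nbhs (q (grng e0)) (setgM O (setgV O)).
  apply: open_nbhs_nbhs; split=> //; exists (q f0), (ginv (q f0)); split=> //.
  - by exists (q f0).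
  - exact: composablegV.
  by rewrite -fe (q_rng hq) gmulgV.
have c : (q \o grng) @ e0 --> q (grng e0).
  apply: (@continuous_comp _ _ _ (@grng S) q); first exact: grng_continuous.
  exact: q_continuous.
move: (c _ nO); apply: (@nbhs_subset S e0) => e /= [g [h [Og Oh gh ghE]]].
have [f Wf fg] := OW _ Og.
exists f; first exact: WU.
apply: (q_rng_inj hq); rewrite fg -(q_rng hq) ghE.
have u : units (gmul g h).
  by apply: bO; right; exists g, h.
by rewrite -[RHS](rng_unit u) grng_mul.
Qed.

(** Continuity of the correspondence sending [e] to the elements of [K] with the
    same range as [e]. With [O] empty it says that having no such element is an
    open condition. *)
Lemma rng_near_compact (K : set S) (O : set G) (e0 : S) : compact K -> open O ->
  (forall f, K f -> grng f = grng e0 -> O (q f)) ->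
  \forall e \near e0, forall f, K f -> grng f = grng e -> O (q f).
Proof.
move=> /compact_near_coveringP covK oO hO.
have := covK S (nbhs e0) (fun e f => grng f = grng e -> O (q f)) _.
apply=> f Kf; have [Of|nOf] := pselect (O (q f)).
  exists (q @^-1` O, setT); last by move=> [f' e] /= [].
  split=> /=; last exact: filterT.
  apply: (@q_continuous f).
  exact: open_nbhs_nbhs.
have ne : grng f <> grng e0 by move=> /(hO _ Kf).
have [U [V [Uf Ve UV]]] := hausdorff_separation (T_hausdorff hT) ne.
exists (grng @^-1` U, grng @^-1` V).
  by split=> /=; exact: grng_continuous.
move=> [f' e] /= [Uf' Ve'] fe; exfalso.
have : (U `&` V) (grng f') by split=> //; rewrite fe.
by rewrite UV.
Qed.

End TwistTopology.

(** * Equivariant functions and their convolution *)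

Section Functions.
Context {R : realType} {S G : spaceGroupoidType}.
Context {act : cplx R -> S -> S} {q : S -> G}.
Hypothesis hq : twist act q.
Implicit Types (t : cplx R) (e f u v : S) (a b : S -> cplx R) (K L : set S).

Let hT := twist_T_groupoid hq.
Let hS : hausdorff_space S := T_hausdorff hT.

Local Notation CSG := (@CSG R S act).
Local Notation CcSG := (@CcSG R S act).
Local Notation NcSG := (@NcSG R S G act q).
Local Notation BcSG := (@BcSG R S G act q).

Lemma osupp_csupp a : osupp a `<=` csupp a.
Proof. exact: subset_closure. Qed.

Lemma csupp_sub a K : compact K -> osupp a `<=` K -> csupp a `<=` K.
Proof.
move=> cK aK; have clK := compact_closed hS cK.
by rewrite [X in _ `<=` X](proj1 (closure_id K) clK); exact: closure_subset.
Qed.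

Lemma csupp_compact a K : compact K -> osupp a `<=` K -> compact (csupp a).
Proof.
move=> cK aK; apply: (subclosed_compact _ cK); first exact: closed_closure.
exact: csupp_sub.
Qed.

Lemma CcSGP a K : CSG a -> compact K -> osupp a `<=` K -> CcSG a.
Proof. by move=> Ca cK aK; split=> //; exact: csupp_compact aK. Qed.

Lemma NcSGP a K : CSG a -> compact K -> osupp a `<=` K ->
  bisection (q @` K) -> NcSG a.
Proof.
move=> Ca cK aK bK; split=> //.
  apply: continuous_compact; first exact/continuous_subspaceT/(q_continuous hq).
  exact: csupp_compact aK.
by apply: sub_bisection bK; apply: image_subset; exact: csupp_sub.
Qed.

(** The definition of [NcSG] only makes the image in [G] of the support compact;
    the support itself is compact because [q] is proper. *)
Lemma NcSG_CcSG a : NcSG a -> CcSG a.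
Proof.
move=> [Ca cK _]; apply: (@CcSGP _ (q @^-1` (q @` csupp a))) => //.
  exact: (q_proper hq).
by move=> e /osupp_csupp ae; exists e.
Qed.

Lemma CcSG_CSG a : CcSG a -> CSG a. Proof. by case. Qed.

Lemma NcSG_CSG a : NcSG a -> CSG a. Proof. by case. Qed.

Lemma NcSG_compact a : NcSG a -> compact (csupp a).
Proof. by move/NcSG_CcSG => []. Qed.

Lemma units_bisection (O : set G) : O `<=` units -> bisection O.
Proof.
move=> Ou; apply/bisectionP; split=> g h /Ou ug /Ou uh.
  by rewrite !src_unit.
by rewrite !rng_unit.
Qed.

Lemma csupp_over_units a : q @` osupp a `<=` units -> q @` csupp a `<=` units.
Proof.
move=> aU _ [e ae <-]; move: ae; rewrite /csupp.
have cl := over_units_closed hq.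
suff : closure (osupp a) `<=` @over_units S G q by apply.
rewrite [X in _ `<=` X](proj1 (closure_id _) cl); apply: closure_subset => f af.
by apply: aU; exists f.
Qed.

Lemma BcSG_NcSG a : BcSG a -> NcSG a.
Proof.
move=> [[Ca ca] aU]; apply: (@NcSGP _ (csupp a)) => //; first exact: osupp_csupp.
by apply: units_bisection; exact: csupp_over_units.
Qed.

Lemma BcSG_CcSG a : BcSG a -> CcSG a. Proof. by case. Qed.

Lemma BcSG_CSG a : BcSG a -> CSG a. Proof. by case=> -[]. Qed.

Lemma CSGact a t e : CSG a -> `|t| = 1 -> a (act t e) = t^* * a e.
Proof. by move=> [_]; apply. Qed.

Lemma CSG_lin (c : cplx R) a b : CSG a -> CSG b -> CSG (c *: a + b).
Proof.
move=> [ca ta] [cb tb]; split=> [|t e t1].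
  change (continuous (fun e => c * a e + b e)).
  exact: (ccontD (ccontM (@ccont_cst R S c) ca) cb).
by rewrite !fctE ta // tb // mulrDr /GRing.scale /= mulrCA.
Qed.

Lemma osupp_lin (c : cplx R) a b : osupp (c *: a + b) `<=` osupp a `|` osupp b.
Proof.
move=> e; rewrite /osupp /= !fctE /GRing.scale /= => ne.
have [a0|] := eqVneq (a e) 0; last by left.
by right; move: ne; rewrite a0 mulr0 add0r.
Qed.

Lemma CSG0 : CSG 0.
Proof.
split=> [|t e _]; first by move=> e; exact: cvg_cst.
by rewrite [LHS]/= mulr0.
Qed.

Lemma osupp0 : osupp (0 : S -> cplx R) = set0.
Proof. by apply/seteqP; split=> // e; rewrite /osupp /= eqxx. Qed.

Lemma CcSG0 : CcSG 0.
Proof. by apply: (@CcSGP _ set0); [exact: CSG0|exact: compact0|rewrite osupp0]. Qed.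

Lemma BcSG0 : BcSG 0.
Proof. by split; [exact: CcSG0|rewrite osupp0 image_set0]. Qed.

Lemma CcSG_lin (c : cplx R) a b : CcSG a -> CcSG b -> CcSG (c *: a + b).
Proof.
move=> [Ca ka] [Cb kb]; apply: (@CcSGP _ (csupp a `|` csupp b)).
- exact: CSG_lin.
- exact: compactU.
by apply: subset_trans (@osupp_lin c a b) _; apply: setUSS; exact: osupp_csupp.
Qed.

Lemma BcSG_lin (c : cplx R) a b : BcSG a -> BcSG b -> BcSG (c *: a + b).
Proof.
move=> [Ca ua] [Cb ub]; split; first exact: CcSG_lin.
move=> _ [e /osupp_lin[ae|be] <-]; first by apply: ua; exists e.
by apply: ub; exists e.
Qed.

Lemma CcSGZ (c : cplx R) a : CcSG a -> CcSG (c *: a).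
Proof. by move=> Ca; rewrite -[X in CcSG X]addr0; exact: CcSG_lin CcSG0. Qed.

Lemma CcSGD a b : CcSG a -> CcSG b -> CcSG (a + b).
Proof. by move=> Ca Cb; rewrite -[a]scale1r; exact: CcSG_lin. Qed.

Lemma CcSGB a b : CcSG a -> CcSG b -> CcSG (a - b).
Proof. by move=> Ca Cb; rewrite addrC -scaleN1r; exact: CcSG_lin. Qed.

Lemma BcSGZ (c : cplx R) a : BcSG a -> BcSG (c *: a).
Proof. by move=> Ca; rewrite -[X in BcSG X]addr0; exact: BcSG_lin BcSG0. Qed.

Lemma BcSGD a b : BcSG a -> BcSG b -> BcSG (a + b).
Proof. by move=> Ca Cb; rewrite -[a]scale1r; exact: BcSG_lin. Qed.

Lemma BcSGB a b : BcSG a -> BcSG b -> BcSG (a - b).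
Proof. by move=> Ca Cb; rewrite addrC -scaleN1r; exact: BcSG_lin. Qed.

(** The multipliers which preserve the equivariance of elements of [CSG]. *)
Definition T_invariant (h : S -> cplx R) : Prop :=
  continuous h /\ forall t e, `|t| = 1 -> h (act t e) = h e.

Lemma CSG_mul h a : T_invariant h -> CSG a -> CSG (fun e => h e * a e).
Proof.
move=> [ch ih] [ca ta]; split=> [|t e t1]; first exact: (ccontM ch ca).
by rewrite ih // ta // mulrCA.
Qed.

Lemma osupp_mul (h : S -> cplx R) a : osupp (fun e => h e * a e) `<=` osupp a.
Proof. by move=> e /=; rewrite /osupp /= mulf_eq0 negb_or => /andP[]. Qed.

Lemma CcSG_mul h a : T_invariant h -> CcSG a -> CcSG (fun e => h e * a e).
Proof.
move=> ih [Ca ca]; apply: CcSGP ca _; first exact: CSG_mul.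
by apply: subset_trans (@osupp_mul h a) _; exact: osupp_csupp.
Qed.

Lemma NcSG_mul h a : T_invariant h -> NcSG a -> NcSG (fun e => h e * a e).
Proof.
move=> ih Na; have [Ca _ ba] := Na; apply: NcSGP (NcSG_compact Na) _ ba.
  exact: CSG_mul.
by apply: subset_trans (@osupp_mul h a) _; exact: osupp_csupp.
Qed.

Lemma T_invariant_norm (k : R -> R) a : continuous k -> CSG a ->
  T_invariant (fun e => rC (k (rabs (a e)))).
Proof.
move=> ck [ca ta]; split.
  apply: cont_rC => e; apply: (@continuous_comp _ _ _ (fun e => rabs (a e)) k).
    exact: cont_rabs.
  exact: ck.
by move=> t e t1; rewrite ta // /rabs normrM norm_conjC t1 mul1r.
Qed.

Lemma T_invariant_q (k : G -> R) : continuous k -> T_invariant (fun e => rC (k (q e))).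
Proof.
move=> ck; split; last by move=> t e t1; rewrite (q_act hq).
apply: cont_rC => e; apply: (@continuous_comp _ _ _ q k).
  exact: (q_continuous hq).
exact: ck.
Qed.

Lemma CSG_star a : CSG a -> CSG (fstar a).
Proof.
move=> [ca ta]; split.
  apply: ccontJ => e; apply: (@continuous_comp _ _ _ (@ginv S) a).
    exact: (ginv_continuous hq).
  exact: ca.
move=> t e t1; rewrite /fstar (act_inv hq) // ta ?norm1J // conjCK.
by rewrite rmorphM.
Qed.

Lemma osupp_star a : osupp (fstar a) `<=` (@ginv S) @` osupp a.
Proof.
move=> e; rewrite /osupp /fstar /= conjC_eq0 => ae.
by exists (ginv e) => //; rewrite ginvK.
Qed.

Lemma compact_ginv K : compact K -> compact ((@ginv S) @` K).
Proof.
by apply: continuous_compact; exact/continuous_subspaceT/(ginv_continuous hq).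
Qed.

Lemma CcSG_star a : CcSG a -> CcSG (fstar a).
Proof.
move=> [Ca ca]; apply: CcSGP (compact_ginv ca) _; first exact: CSG_star.
by apply: subset_trans (@osupp_star a) _; apply: image_subset; exact: osupp_csupp.
Qed.

Lemma NcSG_star a : NcSG a -> NcSG (fstar a).
Proof.
move=> Na; have [Ca _ /bisectionP[sa ra]] := Na.
apply: NcSGP (compact_ginv (NcSG_compact Na)) _ _.
- exact: CSG_star.
- by apply: subset_trans (@osupp_star a) _; apply: image_subset; exact: osupp_csupp.
apply/bisectionP; split=> _ _ [_ [e ae <-] <-] [_ [f af <-] <-].
  rewrite !(q_inv hq) !gsrc_inv => ef; congr ginv.
  by apply: ra ef; [exists e|exists f].
rewrite !(q_inv hq) !grng_inv => ef; congr ginv.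
by apply: sa ef; [exists e|exists f].
Qed.

Lemma BcSG_star a : BcSG a -> BcSG (fstar a).
Proof.
move=> [Ca ua]; split; first exact: CcSG_star.
move=> _ [e /osupp_star[f af <-] <-]; rewrite (q_inv hq) ginv_unit.
  by apply: ua; exists f.
by apply: ua; exists f.
Qed.

Section Convolution.
Variable sigma : G -> S.
Hypothesis hsigma : forall g, q (sigma g) = g.
Local Notation conv := (@conv R S G q sigma).

(** Elements of the fiber over [g] contribute the same term whichever of them the
    section selects: the phases of the two factors cancel. So if the support of
    [a] meets the elements with the range of [e] in one fiber, the sum reduces to
    one term, computed with any [f] in that fiber. *)
Lemma conv_one_term a b e f : CSG a -> CSG b -> grng f = grng e ->
  (forall f', a f' != 0 -> grng f' = grng e -> q f' = q f) ->
  conv a b e = a f * b (gmul (ginv f) e).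
Proof.
move=> Ca Cb fe uniq.
have inD : [set q f] `<=` [set gmul (q e) h | h in [set h | composable (q e) h]].
  move=> _ ->; exists (gmul (ginv (q e)) (q f)).
    rewrite /= /composable grng_mul; first by rewrite grng_inv.
    by rewrite gsrc_inv -!(q_rng hq) fe.
  by rewrite gmulVKg // -!(q_rng hq) fe.
rewrite /conv -(fsbig_widen _ _ _ inD) ?fsbig_set1.
  have [t t1 sf] := q_fiber hq (esym (hsigma (q f))).
  rewrite sf (CSGact _ Ca) // (act_inv hq) // (act_mull hq) ?norm1J //; last first.
    by rewrite /composable gsrc_inv.
  rewrite (CSGact _ Cb) ?norm1J // conjCK mulrACA norm1K // mul1r.
  by [].
move=> g [[h he <-] /= ng] /=.
have [->|ne] := eqVneq (a (sigma (gmul (q e) h))) 0; first by rewrite mul0r.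
exfalso; apply: ng; rewrite -[LHS]hsigma; apply: uniq => //.
by apply: (q_rng_inj hq); rewrite hsigma grng_mul.
Qed.

Lemma conv_no_term a b e : (forall f, a f != 0 -> grng f <> grng e) -> conv a b e = 0.
Proof.
move=> a0; rewrite /conv fsbig1 // => g [h he <-].
have [->|/a0[]] := eqVneq (a (sigma (gmul (q e) h))) 0; first by rewrite mul0r.
by apply: (q_rng_inj hq); rewrite hsigma grng_mul.
Qed.

Lemma NcSG_rng_uniq a f f' : NcSG a -> csupp a f -> csupp a f' ->
  grng f = grng f' -> q f = q f'.
Proof.
move=> [_ _ /bisectionP[_ ra]] af af' ff'.
by apply: ra; [exists f|exists f'|rewrite -!(q_rng hq) ff'].
Qed.

Lemma NcSG_src_uniq a f f' : NcSG a -> csupp a f -> csupp a f' ->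
  gsrc f = gsrc f' -> q f = q f'.
Proof.
move=> [_ _ /bisectionP[sa _]] af af' ff'.
by apply: sa; [exists f|exists f'|rewrite -!(q_src hq) ff'].
Qed.

Lemma conv_NcSGE a b e f : NcSG a -> CSG b -> grng f = grng e -> csupp a f ->
  conv a b e = a f * b (gmul (ginv f) e).
Proof.
move=> Na Cb fe af; apply: conv_one_term => //; first exact: NcSG_CSG.
by move=> f' /osupp_csupp af' f'e; apply: NcSG_rng_uniq Na af' af _; rewrite f'e.
Qed.

Lemma osupp_conv a b : osupp (conv a b) `<=` setgM (osupp a) (osupp b).
Proof.
move=> e ne; apply: contrapT => hn; move: ne; rewrite /osupp /=.
rewrite /conv fsbig1 ?eqxx // => g [h he <-].
set f := sigma _; have fe : grng f = grng e.
  by apply: (q_rng_inj hq); rewrite hsigma grng_mul.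
apply/eqP; rewrite mulf_eq0; apply/norP => -[af bf]; apply: hn.
exists f, (gmul (ginv f) e); split=> //; last by rewrite gmulVKg.
by rewrite /composable grng_mul ?grng_inv // gsrc_inv.
Qed.

Lemma compact_setgM K L : compact K -> compact L -> compact (setgM K L).
Proof.
move=> cK cL.
pose C := [set p : S * S | composable p.1 p.2].
have -> : setgM K L = (fun p => gmul p.1 p.2) @` ((K `*` L) `&` C).
  apply/seteqP; split=> [k [g [h [Kg Lh gh ->]]]|_ [[g h] [[Kg Lh] gh] <-]].
    by exists (g, h).
  by exists g, h.
apply: continuous_compact.
  have [_ m] := T_topological hT.
  by apply: continuous_subspaceW m => p [].
apply: compact_closedI; first exact: compact_setX.
rewrite -[X in closed X]setCK; apply: open_closedC; rewrite openE => -[g h] /= ne.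
have [U [V [Ue Ve UV]]] := hausdorff_separation hS ne.
exists (gsrc @^-1` U, grng @^-1` V).
  by split=> /=; [exact: (gsrc_continuous hq)|exact: (grng_continuous hq)].
move=> [g' h'] /= [Ug Vh]; rewrite /C /composable /= => gh.
have : (U `&` V) (gsrc g') by split=> //; rewrite gh.
by rewrite UV.
Qed.

(** Near [e0] the only possibly nonzero term of the sum is [a f * b (f^-1 e)],
    where [f] is close to the element [f0] of the support of [a] with the range of
    [e0]. Such an [f] exists as the range map is open, and no element of the
    support outside a bisection [O] around [q f0] interferes as the support is
    compact. *)
Lemma conv_continuous a b : NcSG a -> CSG b -> continuous (conv a b).
Proof.
move=> Na Cb e0.
have ka := NcSG_compact Na.
have Ca := NcSG_CSG Na.
have [[f0 af0 fe0]|none] := pselect (exists2 f, csupp a f & grng f = grng e0); last first.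
  apply: (@cont_near_eq _ _ (fun=> 0)); last exact: cvg_cst.
  have hn : forall f, csupp a f -> grng f = grng e0 -> set0 (q f).
    by move=> f af fe; apply: none; exists f.
  have := rng_near_compact hq ka open0 hn.
  by apply: nbhs_subset => e he /=; rewrite conv_no_term // => f /osupp_csupp /he.
move=> V; rewrite (conv_NcSGE Na Cb fe0 af0) => hV.
have c0 : composable (ginv f0) e0 by rewrite /composable gsrc_inv.
(* near (f0, e0), on composable pairs, a f * b (f^-1 e) is in V *)
have [[A B] /= [nA nB] AB] : \forall p \near (f0, e0),
    grng p.1 = grng p.2 -> V (a p.1 * b (gmul (ginv p.1) p.2)).
  have cm := @mul_continuous (cplx R) (a f0, b (gmul (ginv f0) e0)) V hV.
  case: cm => -[V1 V2] /= [hV1 hV2] V12.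
  have hV1' : nbhs f0 (a @^-1` V1) by apply: Ca.1.
  have hV2' : nbhs (gmul (ginv f0) e0) (b @^-1` V2) by apply: Cb.1.
  have [[A B] /= [nA nB] AB] := gmul_near hq c0 hV2'.
  exists (ginv @^-1` A `&` a @^-1` V1, B) => /=.
    by split=> //; apply: filterI => //; exact: (ginv_continuous hq).
  move=> [f e] /= [[Af V1f] Be] fe.
  apply: (V12 (_, _)); split=> //=; apply: (AB (_, _)) => //=.
  by rewrite /composable gsrc_inv.
have [O [oO bO Of0 _ _]] := @etale_nbhs _ _ _ _ _ hq (q f0) setT filterT.
have nO : nbhs f0 (q @^-1` O) by apply: (q_continuous hq); exact: open_nbhs_nbhs.
have nAO : nbhs f0 (A `&` q @^-1` O) by exact: filterI.
have h1 := rng_lift_near hq fe0 nAO.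
have hO : forall f, csupp a f -> grng f = grng e0 -> O (q f).
  by move=> f af fe; rewrite (NcSG_rng_uniq Na af af0) // fe.
have h2 := rng_near_compact hq ka oO hO.
suff : nbhs e0 [set e | V (conv a b e)] by [].
apply: nbhs_subset (filterI nB (filterI h1 h2)) => e [Be [[f [Af Of] fe] he]] /=.
rewrite (@conv_one_term a b e f) //; first exact: (AB (f, e)).
move=> f' /osupp_csupp af' f'e.
have /bisectionP[_ rO] := bO.
by apply: rO; [exact: he af' f'e|exact: Of|rewrite -!(q_rng hq) f'e fe].
Qed.

Lemma conv_CSG a b : NcSG a -> CSG b -> CSG (conv a b).
Proof.
move=> Na Cb; split=> [|t e t1]; first exact: conv_continuous.
have [[f af fe]|none] := pselect (exists2 f, csupp a f & grng f = grng e).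
  rewrite !(@conv_NcSGE a b _ f) // ?(rng_act hq) //.
  rewrite (act_mulr hq) //; last by rewrite /composable gsrc_inv.
  by rewrite (CSGact _ Cb) // mulrCA.
rewrite !conv_no_term ?mulr0 // => f /osupp_csupp af fe; apply: none; exists f => //.
by rewrite fe (rng_act hq).
Qed.

Lemma setgM_sub (T : groupoidType) (O O' P P' : set T) :
  O `<=` O' -> P `<=` P' -> setgM O P `<=` setgM O' P'.
Proof.
move=> OO PP k [g [h [Og Ph gh ->]]].
by exists g, h; split=> //; [exact: OO|exact: PP].
Qed.

Lemma conv_CcSG a b : NcSG a -> CcSG b -> CcSG (conv a b).
Proof.
move=> Na [Cb kb]; apply: (@CcSGP _ (setgM (csupp a) (csupp b))).
- exact: conv_CSG.
- by apply: compact_setgM => //; exact: NcSG_compact.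
apply: subset_trans (@osupp_conv a b) _; apply: setgM_sub; exact: osupp_csupp.
Qed.

Lemma conv_NcSG a b : NcSG a -> NcSG b -> NcSG (conv a b).
Proof.
move=> Na Nb; apply: (@NcSGP _ (setgM (csupp a) (csupp b))).
- by apply: conv_CSG => //; exact: NcSG_CSG.
- by apply: compact_setgM => //; exact: NcSG_compact.
- apply: subset_trans (@osupp_conv a b) _; apply: setgM_sub; exact: osupp_csupp.
apply/bisectionP; split=> _ _ [_ [g [h [ag bh gh ->]]] <-] [_ [g' [h' [ag' bh' gh' ->]]] <-].
  rewrite !(q_mul hq) // !gsrc_mul; try exact: (q_composable hq).
  move=> hh; have hh' := q_src_inj hq hh.
  have qh := NcSG_src_uniq Nb bh bh' hh'.
  rewrite qh (NcSG_src_uniq Na ag ag') //.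
  by rewrite (gh : _ = _) (gh' : _ = _); apply: (q_rng_inj hq); rewrite qh.
rewrite !(q_mul hq) // !grng_mul; try exact: (q_composable hq).
move=> gg; have gg' := q_rng_inj hq gg.
have qg := NcSG_rng_uniq Na ag ag' gg'.
rewrite qg (NcSG_rng_uniq Nb bh bh') //.
by rewrite -(gh : _ = _) -(gh' : _ = _); apply: (q_src_inj hq); rewrite qg.
Qed.

(** Elements of [BcSG] act by multiplication: [grng e] represents the only term. *)
Lemma conv_BcSGE a b e : BcSG a -> CSG b -> conv a b e = a (grng e) * b e.
Proof.
move=> Ba Cb; rewrite (@conv_one_term a b e (grng e)) //.
- rewrite ginv_unit ?gmul_rng //; exact: units_rng.
- exact: BcSG_CSG.
- exact: grng_rng.
move=> f af fe; have uf : units (q f) by apply: Ba.2; exists f.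
by rewrite -fe (q_rng hq) rng_unit.
Qed.

Lemma conv_BcSG a b : BcSG a -> BcSG b -> BcSG (conv a b).
Proof.
move=> Ba Bb; split; first by apply: conv_CcSG; [exact: BcSG_NcSG|exact: BcSG_CcSG].
move=> _ [e + <-]; rewrite /osupp /= conv_BcSGE //; last exact: BcSG_CSG.
by rewrite mulf_eq0 negb_or => /andP[_ be]; apply: Bb.2; exists e.
Qed.

Lemma conv_BcSG_unit a b u : BcSG a -> CSG b -> units u -> conv a b u = a u * b u.
Proof. by move=> Ba Cb uu; rewrite conv_BcSGE // rng_unit. Qed.

(** The product of [O^-1] and [O] consists of units if [O] is a bisection. *)
Lemma conv_star_BcSG a : NcSG a -> BcSG (conv (fstar a) a).
Proof.
move=> Na; split; first by apply: conv_CcSG; [exact: NcSG_star|exact: NcSG_CcSG].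
move=> _ [e /osupp_conv[g [h [/osupp_star[g' ag <-] ah gh ->]]] <-].
move: gh; rewrite /composable gsrc_inv => gh.
rewrite (q_mul hq); last by rewrite /composable gsrc_inv.
rewrite (q_inv hq) (NcSG_rng_uniq Na (osupp_csupp ag) (osupp_csupp ah) gh).
by rewrite gmulVg; exact: units_src.
Qed.

(** The values of [m^* n] and [m n^*] recover products of values of [m] and [n]. *)
Lemma conv_star_val a b e f : NcSG a -> CSG b -> csupp a e -> grng e = grng f ->
  conv (fstar a) b (gmul (ginv e) f) = (a e)^* * b f.
Proof.
move=> Na Cb ae ef; have c : composable (ginv e) f by rewrite /composable gsrc_inv.
rewrite (@conv_one_term _ _ _ (ginv e)) //.
- by rewrite /fstar ginvK gmulVKg.
- exact/CSG_star/NcSG_CSG.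
- by rewrite grng_mul.
move=> f'; rewrite grng_mul // grng_inv /fstar conjC_eq0 => /osupp_csupp af' f'e.
have -> : q f' = ginv (q (ginv f')) by rewrite -(q_inv hq) ginvK.
rewrite (q_inv hq e); congr ginv.
by apply: NcSG_src_uniq Na af' ae _; rewrite gsrc_inv.
Qed.

Lemma conv_val_star a b e f : NcSG a -> CSG b -> csupp a e -> gsrc e = gsrc f ->
  conv a (fstar b) (gmul e (ginv f)) = a e * (b f)^*.
Proof.
move=> Na Cb ae ef; have c : composable e (ginv f) by rewrite /composable grng_inv.
rewrite (@conv_NcSGE _ _ _ e) // ?grng_mul //; last exact: CSG_star.
by rewrite gmulKg // /fstar ginvK.
Qed.

End Convolution.
End Functions.

(** * Functions over the units, cutoffs and the diagonal map *)

Section Calculus.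
Context {R : realType} {S G : spaceGroupoidType}.
Context {act : cplx R -> S -> S} {q : S -> G}.
Hypothesis hq : twist act q.
Implicit Types (t : cplx R) (e f u v : S) (a b : S -> cplx R).

Local Notation CSG := (@CSG R S act).
Local Notation CcSG := (@CcSG R S act).
Local Notation NcSG := (@NcSG R S G act q).
Local Notation phase := (@phase R S act).
Local Notation BcSG := (@BcSG R S G act q).

Lemma BcSG_out a e : BcSG a -> ~ units (q e) -> a e = 0.
Proof.
move=> Ba nu; apply/eqP/negPn/negP => ae; apply: nu.
by apply: Ba.2; exists e.
Qed.

Lemma CSG_over_units a e : CSG a -> units (q e) ->
  exists2 t, `|t| = 1 & a e = t^* * a (gsrc e).
Proof.
move=> Ca /(q_unit_phase hq)[t t1 eE]; exists t => //.
by rewrite {1}eE (CSGact _ Ca).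
Qed.

(** By equivariance an element of [BcSG] is determined by its values on the units.
    All identities in the commutative algebra [BcSG] are reduced in this way to
    identities between complex numbers. *)
Lemma BcSG_ext a b : BcSG a -> BcSG b -> (forall u, units u -> a u = b u) -> a = b.
Proof.
move=> Ba Bb ab; apply/funext => e; have [ue|nu] := pselect (units (q e)).
  have [t t1 eE] := q_unit_phase hq ue.
  rewrite eE (CSGact _ (BcSG_CSG Ba)) // (CSGact _ (BcSG_CSG Bb)) //.
  by rewrite ab //; exact: units_src.
by rewrite !BcSG_out.
Qed.

(** The equivariant function with value 1 on the units, supported over them. It
    identifies functions on the units with equivariant functions. *)
Definition unit_section e : cplx R :=
  if q e \in units then (phase e)^* else 0.

Lemma unit_section_unit u : units u -> unit_section u = 1.
Proof.
move=> uu; rewrite /unit_section ifT ?inE; last exact: (q_units hq).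
by rewrite -{1}(act1 hq u) (phase_act hq) ?normr1 // conjC1.
Qed.

Lemma CSG_unit_section : CSG unit_section.
Proof.
split.
  apply: (over_units_cutoff_continuous hq) => e ue.
  apply: (@continuous_comp _ _ _ (phase) (fun z => z^*)).
    exact: (phase_continuous hq).
  exact: conj_continuous.
move=> t e t1; rewrite /unit_section (q_act hq) //; case: ifPn; rewrite ?mulr0 // inE => ue.
have [p1 {1}->] := phaseP hq ue.
rewrite -(actM hq) // (phase_act hq) ?rmorphM //; last exact: units_src.
by rewrite normrM t1 p1 mulr1.
Qed.

(** The continuous functional calculus of [BcSG], through the identification of
    its elements with functions on the units. *)
Definition unit_calculus (psi : cplx R -> cplx R) a e := unit_section e * psi (a (gsrc e)).

Lemma unit_calculusE psi a u : units u -> unit_calculus psi a u = psi (a u).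
Proof. by move=> uu; rewrite /unit_calculus unit_section_unit // mul1r src_unit. Qed.

Lemma BcSG_unit_calculus psi a : continuous psi -> psi 0 = 0 -> BcSG a ->
  BcSG (unit_calculus psi a).
Proof.
move=> cpsi psi0 Ba; have [[Ca ka] _] := Ba.
have out e : ~ units (q e) -> unit_calculus psi a e = 0.
  move=> nu; rewrite /unit_calculus /unit_section ifF ?mul0r //.
  by apply/negbTE; rewrite notin_setE.
have CC : CSG (unit_calculus psi a).
  split=> [|t e t1].
    apply: (ccontM CSG_unit_section.1) => e.
    have cs : {for e, continuous (fun e => a (gsrc e))}.
      apply: (@continuous_comp _ _ _ (@gsrc S) a); first exact: (gsrc_continuous hq).
      exact: Ca.1.
    exact: (@continuous_comp S (cplx R) (cplx R) (fun e => a (gsrc e)) psi e cs (cpsi _)).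
  by rewrite /unit_calculus (CSGact _ CSG_unit_section) // (src_act hq) // mulrA.
split; last first.
  move=> _ [e + <-]; rewrite /osupp /= => ne; apply: contrapT => /out ee.
  by rewrite ee eqxx in ne.
apply: (CcSGP hq CC ka) => e; rewrite /osupp /= => ne.
apply: osupp_csupp; rewrite /osupp /=; apply: contra_neq ne => ae.
have [ue|/out//] := pselect (units (q e)).
have [t t1] := CSG_over_units Ca ue; rewrite ae => /esym/eqP.
rewrite mulf_eq0 conjC_eq0 -normr_eq0 t1 oner_eq0 /= => /eqP as0.
by rewrite /unit_calculus as0 psi0 mulr0.
Qed.

(** A Urysohn function of [g] and of the complement of a bisection [O], reshaped
    so as to be 1 near [g] and supported in a closed subset of [O]. *)
Lemma bisection_cutoff (g : G) : exists k : G -> R,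
  [/\ continuous k, forall h, 0 <= k h <= 1, nbhs g [set h | k h = 1] &
      forall a, CcSG a -> NcSG (fun e => rC (k (q e)) * a e)].
Proof.
have [O [oO bO Og _ _]] := @etale_nbhs _ _ _ _ _ hq g setT filterT.
have reg := @locally_compact_completely_regular G R
  (twist_locally_compact hq) (twist_hausdorff hq).
have nOg : ~ (~` O) g by apply.
have /(@uniform_separatorP _ R)[f [cf f01 f0 f1]] := reg g (~` O) (open_closedC oO) nOg.
pose k h := Num.min 1 (Num.max 0 (2 - 3 * f h)).
have ck : continuous k.
  have c1 : continuous (fun h => 2 - 3 * f h).
    move=> h; apply: (@cvgB R R); first exact: cvg_cst.
    by apply: (@cvgM R); [exact: cvg_cst|exact: cf].
  exact: (rcont_min (@rcont_cst R G 1) (rcont_max (@rcont_cst R G 0) c1)).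
exists k; split=> //.
- by move=> h; rewrite /k ge_min le_min lexx ler01 /= le_max lexx.
- have fg : f g = 0 by apply: (f0 (f g)); exists g.
  have : f @ g --> f g by exact: cf.
  move=> /(_ [set x | x < 3^-1]) nf.
  have : nbhs (f g) [set x | x < 3^-1].
    by rewrite fg; apply: (@lt_nbhsl R); rewrite invr_gt0.
  move=> /nf; apply: nbhs_subset => h /= fh; rewrite /k.
  have fh' : 1 <= 2 - 3 * f h by lra.
  rewrite (@max_idPr _ _ 0 _ _); first by apply/min_idPl.
  by apply: le_trans fh'.
move=> a Ca; have [Csa ka] := Ca.
pose C := [set h | f h <= 2 / 3].
have clC : closed C.
  have /continuous_closedP cc := cf.
  exact: (cc _ (@closed_le R (2 / 3))).
have CO : C `<=` O.
  move=> h Ch; apply: contrapT => nOh.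
  have : f h = 1 by apply: (f1 (f h)); exists h.
  by move: Ch; rewrite /C /=; lra.
apply: (@NcSGP _ _ _ _ _ hq _ (csupp a `&` q @^-1` C)).
- by apply: CSG_mul => //; exact: (T_invariant_q hq).
- apply: compact_closedI => //.
  by have /continuous_closedP := q_continuous hq; apply.
- move=> e; rewrite /osupp /= mulf_eq0 negb_or => /andP[ke ae].
  split; first exact: osupp_csupp.
  rewrite /C /= leNgt; apply/negP => fe; move/eqP: ke; apply.
  rewrite /k (@max_idPl _ _ 0 _ _); first by rewrite (@min_idPr _ _ 1 0 _) // ler01.
  by lra.
by apply: sub_bisection bO => _ [e [_ Ce] <-]; exact: CO.
Qed.

(** [NcSG] spans [CcSG]. A finite family of cutoffs covers the support of [a]; the
    first cutoff [k] splits [a] as [k a + (1 - k) a], and the second summand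
    vanishes wherever [k] is 1, so that it is covered by the remaining cutoffs. *)
Lemma CcSG_bisection_ind (V : set (S -> cplx R)) : V 0 ->
  (forall n b, NcSG n -> CcSG b -> V b -> V (n + b)) -> CcSG `<=` V.
Proof.
move=> V0 VD a0 Ca0; have [_ ka0] := Ca0.
pose k g := projT1 (cid (bisection_cutoff g)).
have kP g : [/\ continuous (k g), forall h, 0 <= k g h <= 1,
    nbhs g [set h | k g h = 1] &
      forall a, CcSG a -> NcSG (fun e => rC (k g (q e)) * a e)].
  exact: (projT2 (cid (bisection_cutoff g))).
have cK : compact (q @` csupp a0).
  by apply: continuous_compact => //; exact/continuous_subspaceT/(q_continuous hq).
(* finite subfamilies of cutoffs, ordered by inclusion *)
pose F := filter_from [set: seq G] (fun s0 => [set s : seq G | {subset s0 <= s}]).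
have FF : Filter F.
  apply: filter_from_filter; first by exists [::].
  move=> s1 s2 _ _; exists (s1 ++ s2) => // s /= sub.
  by split=> g gs; apply: sub; rewrite mem_cat gs ?orbT.
have [D _ /(_ D (fun _ => id)) cov] :
    F [set s : seq G | q @` csupp a0 `<=` [set h | exists2 g, g \in s & k g h = 1]].
  have /compact_near_coveringP cov0 := cK.
  apply: (cov0 (seq G) F (fun s h => exists2 g, g \in s & k g h = 1) FF) => g _.
  have [_ _ nk _] := kP g.
  exists ([set h | k g h = 1], [set s : seq G | g \in s]); last first.
    by move=> [h s] /= [kh gs]; exists g.
  by split=> //=; exists [:: g] => // s /=; apply; rewrite inE.
have : forall e, a0 e != 0 -> exists2 g, g \in D & k g (q e) = 1.
  by move=> e ae; apply: cov; exists e => //; exact: osupp_csupp.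
move: Ca0; elim: D {cov ka0 cK} a0 => [|g s IH] a Ca ha.
  have -> : a = 0 => //; apply/funext => e; apply/eqP/negPn/negP => /ha[g].
  by rewrite in_nil.
have [ck k01 _ kN] := kP g.
pose n e := rC (k g (q e)) * a e.
have Nn : NcSG n by exact: kN.
have Cb : CcSG (a - n) by apply: (CcSGB hq) => //; exact: (NcSG_CcSG hq).
rewrite -[a](subrK n) addrC; apply: VD => //; apply: IH => // e.
rewrite !fctE /n -{1}[a e]mul1r -mulrBl mulf_eq0 negb_or subr_eq0 => /andP[k1 ae].
have [g'] := ha e ae; rewrite inE => /orP[/eqP->|? ?]; last by exists g'.
by move=> kg; rewrite kg eqxx in k1.
Qed.

Lemma BcSG_diag a : CcSG a -> BcSG (diag q a).
Proof.
move=> [Ca ka].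
have sub : osupp (diag q a) `<=` osupp a.
  by move=> e; rewrite /osupp /diag /=; case: ifPn => //; rewrite eqxx.
split; last first.
  move=> _ [e + <-]; rewrite /osupp /diag /=; case: ifPn; rewrite ?eqxx //.
  by rewrite inE.
apply: (@CcSGP _ _ _ _ _ hq _ (csupp a)) => //; last first.
  by apply: subset_trans sub _; exact: osupp_csupp.
split; first by apply: (over_units_cutoff_continuous hq) => e _; exact: Ca.1.
move=> t e t1; rewrite /diag (q_act hq) //; case: ifPn => _; rewrite ?mulr0 //.
exact: (CSGact _ Ca).
Qed.

Lemma diag_unit a e : units (q e) -> diag q a e = a e.
Proof. by move=> ue; rewrite /diag ifT // inE. Qed.

Lemma diag_BcSG a : BcSG a -> diag q a = a.
Proof.
move=> Ba; apply/funext => e; rewrite /diag; case: ifPn => //.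
by rewrite notin_setE => nu; rewrite BcSG_out.
Qed.

Lemma diag_lin (c : cplx R) a b : diag q (c *: a + b) = c *: diag q a + diag q b.
Proof.
apply/funext => e; rewrite !fctE /diag; case: ifPn => // _.
by rewrite /GRing.scale /= mulr0 addr0.
Qed.

(** If [D(n) n^*] does not vanish at [e], then both [grng e] and [e^-1] are in the
    support of [n], and they have the same source. *)
Lemma conv_diag_star sigma n : (forall g, q (sigma g) = g) -> NcSG n ->
  BcSG (conv q sigma (diag q n) (fstar n)).
Proof.
move=> hsigma Nn; have Bd := BcSG_diag (NcSG_CcSG hq Nn).
have Cs := CSG_star hq (NcSG_CSG Nn).
split.
  apply: (conv_CcSG hq hsigma); first exact: (BcSG_NcSG hq).
  exact/(CcSG_star hq)/(NcSG_CcSG hq).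
move=> _ [e + <-]; rewrite /osupp /= (conv_BcSGE hq hsigma) // mulf_eq0 negb_or.
rewrite diag_unit; last by rewrite (q_rng hq); exact: units_rng.
rewrite /fstar conjC_eq0 => /andP[nr ni].
have := NcSG_src_uniq hq Nn (osupp_csupp nr) (osupp_csupp ni).
rewrite gsrc_inv gsrc_rng => /(_ erefl); rewrite (q_rng hq) (q_inv hq) => qe.
have u : units (ginv (q e)) by rewrite -qe; exact: units_rng.
by rewrite -[q e]ginvK; rewrite ginv_unit.
Qed.

End Calculus.

(** * Norm estimates *)

Section RealNorms.
Context {R : realType}.
Implicit Types (z w : cplx R).

Lemma rabs_ge0 z : 0 <= rabs z.
Proof. by rewrite -rC_le -rabsE rC0. Qed.

Lemma rabsM z w : rabs (z * w) = rabs z * rabs w.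
Proof. by apply: rC_inj; rewrite rCM -!rabsE normrM. Qed.

Lemma rabsJ z : rabs z^* = rabs z.
Proof. by rewrite /rabs norm_conjC. Qed.

Lemma rabs_rC (x : R) : rabs (rC x) = `|x|.
Proof. by rewrite /rabs norm_rC. Qed.

Lemma rabs0 : rabs (0 : cplx R) = 0.
Proof. by rewrite /rabs normr0. Qed.

Lemma rabs_eq0 z : rabs z = 0 -> z = 0.
Proof. by move=> z0; apply/eqP; rewrite -normr_eq0 rabsE z0. Qed.

Lemma rabsCK z : z * z^* = rC (rabs z ^+ 2).
Proof. by rewrite -normCK rabsE rCX. Qed.

Lemma rabs_reC z : `|reC z| <= rabs z.
Proof. by rewrite -rC_le -rabsE; exact: normc_ge_Re. Qed.

Context {V : normedModType (cplx R)}.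
Implicit Types (x y : V).

Definition rnorm x : R := reC `|x|.

Lemma rnormE x : `|x| = rC (rnorm x).
Proof. exact: ge0_rC. Qed.

Lemma rnorm_ge0 x : 0 <= rnorm x.
Proof. by rewrite -rC_le -rnormE rC0. Qed.

Lemma rnormD x y : rnorm (x + y) <= rnorm x + rnorm y.
Proof. by rewrite -rC_le rCD -!rnormE ler_normD. Qed.

Lemma rnormN x : rnorm (- x) = rnorm x.
Proof. by rewrite /rnorm normrN. Qed.

Lemma rnormB x y : rnorm (x - y) <= rnorm x + rnorm y.
Proof. by rewrite -(rnormN y) rnormD. Qed.

Lemma rnormC x y : rnorm (x - y) = rnorm (y - x).
Proof. by rewrite /rnorm distrC. Qed.

Lemma rnormZ z x : rnorm (z *: x) = rabs z * rnorm x.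
Proof. by apply: rC_inj; rewrite rCM -!rnormE -rabsE normrZ. Qed.

Lemma rnorm0 : rnorm 0 = 0.
Proof. by rewrite /rnorm normr0. Qed.

Lemma rnorm_eq0 x : rnorm x = 0 -> x = 0.
Proof. by move=> x0; apply/eqP; rewrite -normr_eq0 rnormE x0. Qed.

End RealNorms.

Section CstarNorm.
Context {R : realType} {A : cstarAlgType R}.
Implicit Types x y : A.

Lemma rnormM x y : rnorm (amul x y) <= rnorm x * rnorm y.
Proof. by rewrite -rC_le rCM -!rnormE anormM. Qed.

Lemma rnorm_cstar x : rnorm (amul (astar x) x) = rnorm x ^+ 2.
Proof. by apply: rC_inj; rewrite rCX -!rnormE anorm_cstar. Qed.

(** From the C*-identity: [|x|^2 = |x^* x| <= |x^*| |x|]. *)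
Lemma rnorm_star x : rnorm (astar x) = rnorm x.
Proof.
have le y : rnorm y <= rnorm (astar y).
  have [y0|y0] := eqVneq (rnorm y) 0; first by rewrite y0 rnorm_ge0.
  have y1 : 0 < rnorm y by rewrite lt_def y0 rnorm_ge0.
  by rewrite -(ler_pM2r y1) -expr2 -rnorm_cstar rnormM.
by apply: le_anti; rewrite le /= andbT -{2}(astarK x) le.
Qed.

End CstarNorm.

Section NormEstimates.
Context {R : realType} {S G : spaceGroupoidType}.
Context {act : cplx R -> S -> S} {q : S -> G} {sigma : G -> S}.
Context {nrm : (S -> cplx R) -> cplx R}.
Context {A : cstarAlgType R} {iota : (S -> cplx R) -> A}.
Hypothesis hq : twist act q.
Hypothesis hsigma : forall g, q (sigma g) = g.
Hypothesis hnrm : cstar_norm act q sigma nrm.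
Hypothesis hD : diag_contractive act q nrm.
Hypothesis hA : completion act q sigma nrm iota.
Implicit Types (t : cplx R) (e f u v : S) (a b : S -> cplx R).

Local Notation CSG := (@CSG R S act).
Local Notation CcSG := (@CcSG R S act).
Local Notation NcSG := (@NcSG R S G act q).
Local Notation BcSG := (@BcSG R S G act q).
Local Notation conv := (@conv R S G q sigma).
Local Notation unit_calculus := (@unit_calculus R S G act q).

Let BC a (h : BcSG a) : CcSG a := BcSG_CcSG h.
Let BS a (h : BcSG a) : CSG a := BcSG_CSG h.
Let NS a (h : NcSG a) : CSG a := NcSG_CSG h.

Lemma iota0 : iota 0 = 0.
Proof.
have := iotaZ hA 0 (CcSG0 hq).
by rewrite scale0r scale0r.
Qed.

Lemma iota_lin (c : cplx R) a b : CcSG a -> CcSG b ->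
  iota (c *: a + b) = c *: iota a + iota b.
Proof.
move=> Ca Cb; rewrite (iotaD hA) ?(iotaZ hA) //; exact: (CcSGZ hq).
Qed.

Lemma iotaB a b : CcSG a -> CcSG b -> iota (a - b) = iota a - iota b.
Proof.
move=> Ca Cb; rewrite addrC -scaleN1r iota_lin // scaleN1r addrC //.
Qed.

Lemma iota_eq0 a : CcSG a -> iota a = 0 -> a = 0.
Proof.
move=> Ca a0; apply: (nrm0_eq0 hnrm Ca).
by rewrite -(iota_norm hA) // a0 normr0.
Qed.

Lemma iota_diag a : CcSG a -> rnorm (iota (diag q a)) <= rnorm (iota a).
Proof.
move=> Ca; rewrite -rC_le -!rnormE !(iota_norm hA) //; first exact: hD.
exact/BC/(BcSG_diag hq).
Qed.

Lemma NcSG_iota_cstar a : NcSG a -> rnorm (iota (conv (fstar a) a)) = rnorm (iota a) ^+ 2.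
Proof.
move=> Na; have Ca := NcSG_CcSG hq Na.
rewrite (iotaM hA) //; last exact: (CcSG_star hq).
by rewrite (iota_star hA) // rnorm_cstar.
Qed.

Lemma conv_star_unit a b u : BcSG a -> CSG b -> units u ->
  conv (fstar a) b u = (a u)^* * b u.
Proof.
move=> Ba Cb uu; rewrite (conv_BcSG_unit hq) //; last exact: (BcSG_star hq).
by rewrite /fstar ginv_unit.
Qed.

(** If [1 + w] is unitary then [w^* w = - w - w^*], whence [|w|^2 <= 2 |w|]. This
    bounds the norm of some functions by their values only. *)
Lemma quasi_unitary_norm_le2 w : BcSG w ->
  (forall u, units u -> rabs (1 + w u) = 1) -> rnorm (iota w) <= 2.
Proof.
move=> Bw w1; have Bs := BcSG_star hq Bw.
have : conv (fstar w) w = - w - fstar w.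
  apply: (BcSG_ext hq).
  - exact: (conv_BcSG hq).
  - by apply: (BcSGB hq) => //; rewrite -scaleN1r; exact: (BcSGZ hq).
  move=> u uu; rewrite conv_star_unit //; last exact: BS.
  rewrite !fctE /fstar ginv_unit //.
  have := rabsCK (1 + w u); rewrite w1 // expr1n rC1 rmorphD rmorph1 => h.
  apply/eqP; rewrite -subr_eq0; apply/eqP.
  transitivity ((1 + w u) * (1 + (w u)^*) - 1); first by ring.
  by rewrite h subrr.
move=> /(congr1 (fun a => rnorm (iota a))).
rewrite NcSG_iota_cstar; last exact: (BcSG_NcSG hq).
have Cw := BcSG_CcSG Bw; have Cs := BcSG_CcSG Bs.
have CN : CcSG (- w) by rewrite -scaleN1r; exact: (CcSGZ hq).
rewrite iotaB // -scaleN1r (iotaZ hA) // scaleN1r (iota_star hA) // => h.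
have := rnormB (- iota w) (astar (iota w)).
rewrite -h rnormN rnorm_star -mulr2n -mulr_natl.
by have := rnorm_ge0 (iota w); nra.
Qed.

(** A real function [x] with values in [[-1, 1]] is the imaginary part of the
    unitary [sqrt (1 - x^2) + i x]. *)
Lemma BcSG_re_norm_le2 a : BcSG a -> (forall u, units u -> rabs (a u) <= 1) ->
  rnorm (iota (unit_calculus (fun z => rC (reC z)) a)) <= 2.
Proof.
move=> Ba a1.
(* the unitary minus 1, so that the function vanishes where [a] does *)
pose psi (z : cplx R) : cplx R :=
  rC (Num.sqrt (1 - reC z * reC z)) + 'i * rC (reC z) - 1.
have cre := @reC_continuous R.
have cpsi : continuous psi.
  apply: ccontD; last exact: ccont_cst.
  apply: ccontD; last first.
    apply: ccontM; first exact: ccont_cst.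
    exact: (cont_rC cre).
  apply: cont_rC; apply: rcont_sqrt; apply: rcontD; first exact: rcont_cst.
  exact: (rcontN (rcontM cre cre)).
have re0 : reC (0 : cplx R) = 0 by [].
have psi0 : psi 0 = 0.
  by rewrite /psi re0 mulr0 subr0 sqrtr1 rC0 mulr0 addr0 rC1 subrr.
pose w := unit_calculus psi a.
have Bw : BcSG w by exact: (BcSG_unit_calculus hq cpsi psi0 Ba).
have w2 : rnorm (iota w) <= 2.
  apply: quasi_unitary_norm_le2 => // u uu; rewrite /w (unit_calculusE hq) // /psi addrC subrK.
  set x := reC _; have x1 : x * x <= 1.
    have := rabs_reC (a u); rewrite -/x => xl; have := a1 u uu.
    have := normr_ge0 x; have : `|x| * `|x| = x * x by rewrite -expr2 real_normK ?num_real.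
    nra.
  set s := Num.sqrt _; have ss : s * s = 1 - x * x.
    by rewrite -expr2 sqr_sqrtr // subr_ge0.
  have h : rabs (rC s + 'i * rC x) ^+ 2 = 1.
    apply: rC_inj; rewrite -rabsCK rmorphD rmorphM /= conjCi !conj_rC.
    transitivity (rC s * rC s - 'i ^+ 2 * (rC x * rC x)); first by ring.
    by rewrite sqrCi mulN1r opprK -!rCM ss -rCD subrK.
  have := rabs_ge0 (rC s + 'i * rC x); nra.
pose r := unit_calculus (fun z => rC (reC z)) a.
have Br : BcSG r by exact: (BcSG_unit_calculus hq (cont_rC cre) (erefl : rC (reC 0) = 0) Ba).
have Bs := BcSG_star hq Bw.
have : (2 * 'i) *: r = w - fstar w.
  apply: (BcSG_ext hq); first exact: (BcSGZ hq).
    exact: (BcSGB hq).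
  move=> u uu; rewrite !fctE /fstar ginv_unit // /w /r !(unit_calculusE hq) // /psi.
  rewrite /GRing.scale /= rmorphB rmorphD rmorphM /= conjCi !conj_rC ?conjC1.
  by ring.
move=> /(congr1 (fun a => rnorm (iota a))).
rewrite (iotaZ hA) ?iotaB ?(iota_star hA) //; try exact: BC.
rewrite rnormZ => h.
have := rnormB (iota w) (astar (iota w)); rewrite -h rnorm_star.
have -> : rabs (2 * 'i) = 2 :> R.
  rewrite rabsM; have -> : rabs ('i : cplx R) = 1 by rewrite /rabs normCi.
  by rewrite mulr1 (_ : 2 = rC 2) ?rabs_rC ?ger0_norm // rCD.
by move: w2; rewrite -/r; lra.
Qed.

Lemma BcSG_norm_le4 a : BcSG a -> (forall u, units u -> rabs (a u) <= 1) ->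
  rnorm (iota a) <= 4.
Proof.
move=> Ba a1.
have Bb : BcSG ((- 'i) *: a) by exact: (BcSGZ hq).
have h1 := BcSG_re_norm_le2 Ba a1.
have h2 : rnorm (iota (unit_calculus (fun z => rC (reC z)) ((- 'i) *: a))) <= 2.
  apply: BcSG_re_norm_le2 => // u uu; rewrite /GRing.scale /= rabsM.
  have -> : rabs (- 'i : cplx R) = 1 by rewrite /rabs normrN normCi.
  by rewrite mul1r a1.
have cre := cont_rC (@reC_continuous R).
have Bre b : BcSG b -> BcSG (unit_calculus (fun z => rC (reC z)) b).
  exact: (BcSG_unit_calculus hq cre (erefl : rC (reC 0) = 0)).
have B1 := Bre _ Ba.
have B2 := Bre _ Bb.
have -> : a = 'i *: unit_calculus (fun z => rC (reC z)) ((- 'i) *: a) +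
              unit_calculus (fun z => rC (reC z)) a.
  apply: (BcSG_ext hq) => //; first exact: (BcSG_lin hq).
  move=> u uu; rewrite !fctE !(unit_calculusE hq) // /GRing.scale /= addrC.
  (* [Re (- i z) = Im z] *)
  have -> : reC (- 'i * a u) = complex.Im (a u : R[i]).
    by rewrite -complexiE mulNr mulrC /reC raddfN /= ReiNIm opprK.
  by rewrite -complexiE; exact: complexE.
rewrite iota_lin; try exact: BC.
apply: le_trans (rnormD _ _) _; rewrite rnormZ.
have -> : rabs ('i : cplx R) = 1 by rewrite /rabs normCi.
by rewrite mul1r; lra.
Qed.

(** The constant 4 improves to 1: a bound [|f| <= 1 + c], valid for all [f] with
    values in the unit disc, applied to [f^* f] gives [|f|^2 <= 1 + c] and thus
    [|f| <= 1 + c / 2]. *)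
Lemma BcSG_norm_le1 a : BcSG a -> (forall u, units u -> rabs (a u) <= 1) ->
  rnorm (iota a) <= 1.
Proof.
have H n : forall a, BcSG a -> (forall u, units u -> rabs (a u) <= 1) ->
    rnorm (iota a) <= 1 + 4 * 2^-1 ^+ n.
  elim: n => [|n IH] {}a Ba a1.
    by rewrite expr0 mulr1; have := BcSG_norm_le4 Ba a1; lra.
  have Bs := BcSG_star hq Ba.
  have := IH (conv (fstar a) a) (conv_BcSG hq hsigma Bs Ba) _.
  rewrite NcSG_iota_cstar => [h|]; last exact: (BcSG_NcSG hq).
  have {}h : rnorm (iota a) ^+ 2 <= 1 + 4 * 2^-1 ^+ n.
    apply: h => u uu; rewrite conv_star_unit //; last exact: BS.
    by rewrite rabsM rabsJ; have := a1 u uu; have := rabs_ge0 (a u); nra.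
  have : 0 < (2^-1 : R) ^+ n by rewrite exprn_gt0 // invr_gt0.
  rewrite exprS; set P := (2^-1) ^+ n in h *; move=> P0.
  have -> : 1 + 4 * (2^-1 * P) = 1 + 2 * P by field.
  rewrite -(@ler_pXn2r _ 2) ?nnegrE ?rnorm_ge0 //; last by lra.
  by apply: le_trans h _; nra.
move=> Ba a1; apply/ler_addgt0Pr => eps eps0.
have c : (fun n => (2^-1 : R) ^+ n) @ \oo --> 0.
  by apply: cvg_expr; rewrite ger0_norm ?invr_ge0 // invf_lt1 // ltr1n.
have e4 : 0 < eps / 4 by rewrite divr_gt0.
move/cvgrPdist_lt : c => /(_ _ e4)[n _ /(_ n (leqnn n))] /=.
rewrite sub0r normrN => hn; apply: le_trans (H n a Ba a1) _.
by have := ler_norm ((2^-1 : R) ^+ n); lra.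
Qed.

Lemma BcSG_norm_le_sup a (M : R) : BcSG a -> 0 <= M ->
  (forall u, units u -> rabs (a u) <= M) -> rnorm (iota a) <= M.
Proof.
move=> Ba M0 aM; have [M00|M1] := eqVneq M 0.
  have -> : a = 0.
    apply: (BcSG_ext hq) => //; first exact: (BcSG0 hq).
    move=> u uu; apply: rabs_eq0; apply: le_anti; rewrite rabs_ge0 andbT.
    by rewrite -M00 aM.
  by rewrite iota0 rnorm0.
have {M1}Mp : 0 < M by rewrite lt_def M1.
have : rnorm (iota (rC M^-1 *: a)) <= 1.
  apply: BcSG_norm_le1; first exact: (BcSGZ hq).
  move=> u uu; rewrite /GRing.scale /= rabsM rabs_rC gtr0_norm ?invr_gt0 //.
  by rewrite ler_pdivrMl // mulr1 aM.
rewrite (iotaZ hA); last exact: BC.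
by rewrite rnormZ rabs_rC gtr0_norm ?invr_gt0 // ler_pdivrMl // mulr1.
Qed.

Lemma geometric_le0 (x c : R) : 0 <= c < 1 -> (forall n, x <= c ^+ n) -> x <= 0.
Proof.
move=> /andP[c0 c1] xc; apply/ler_addgt0Pr => eps eps0; rewrite add0r.
have cc : (fun n => c ^+ n) @ \oo --> 0 by apply: cvg_expr; rewrite ger0_norm.
move/cvgrPdist_lt : cc => /(_ _ eps0)[n _ /(_ n (leqnn n))] /=.
rewrite sub0r normrN => hn; apply: le_trans (xc n) _.
by apply: le_trans (ler_norm _) _; exact: ltW.
Qed.

(** Suppose that [|a| < r < |a u|]. A function [psi] of [a] with [|psi| <= 1] that
    is supported where [|a|] exceeds [r] can be divided by [a], and [r psi / a] is a
    function of the same kind; so [|psi| <= (|a| / r) |r psi / a|]. Iterating, all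
    these functions have norm 0, although one of them does not vanish at [u]. *)
Lemma BcSG_value_le_norm a u : BcSG a -> units u -> rabs (a u) <= rnorm (iota a).
Proof.
move=> Ba uu; rewrite leNgt; apply/negP => lt.
set rho := rnorm (iota a) in lt; pose r := (rho + rabs (a u)) / 2.
have rho0 : 0 <= rho by exact: rnorm_ge0.
have r_rho : rho < r by rewrite /r; lra.
have r_au : r < rabs (a u) by rewrite /r; lra.
have r0 : 0 < r by lra.
clearbody r.
pose m (z : cplx R) := Num.max (rabs z) r.
have m_r z : r <= m z by rewrite /m le_max lexx orbT.
have m_z z : rabs z <= m z by rewrite /m le_max lexx.
have m0 z : m z != 0 by have := m_r z; lra.
have cm : continuous m.
  exact: (rcont_max (@rabs_continuous R) (@rcont_cst R (cplx R) r)).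
pose good (psi : cplx R -> cplx R) := [/\ continuous psi,
  forall z, rabs z <= r -> psi z = 0 & forall z, rabs (psi z) <= 1].
have z0 (psi : cplx R -> cplx R) : good psi -> psi 0 = 0.
  by case=> _ + _; apply; rewrite rabs0 ltW.
have contr n : forall psi, good psi -> rnorm (iota (unit_calculus psi a)) <= (rho / r) ^+ n.
  elim: n => [|n IH] psi gpsi.
    rewrite expr0; have [cpsi _ psi1] := gpsi.
    apply: BcSG_norm_le1; first exact: (BcSG_unit_calculus hq cpsi (z0 _ gpsi) Ba).
    by move=> v uv; rewrite (unit_calculusE hq).
  have [cpsi psir psi1] := gpsi.
  (* [phi z = r * psi z / z], written so as to be visibly continuous *)
  pose phi (z : cplx R) := rC (r * ((m z)^-1 * (m z)^-1)) * (psi z * z^*).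
  have gphi : good phi.
    split.
    - apply: ccontM.
        have cmV := rcontV cm m0.
        exact: (cont_rC (rcontM (@rcont_cst R (cplx R) r) (rcontM cmV cmV))).
      exact: (ccontM cpsi (@conj_continuous R)).
    - by move=> z zr; rewrite /phi psir // mul0r mulr0.
    move=> z; rewrite /phi !rabsM rabsJ rabs_rC.
    have mp : 0 < m z by have := m_r z; lra.
    have im0 : 0 < (m z)^-1 by rewrite invr_gt0.
    have im0' := ltW im0; have r0' := ltW r0.
    rewrite ger0_norm; last by rewrite !mulr_ge0.
    have h1 : r * (m z)^-1 <= 1 by rewrite ler_pdivrMr // mul1r.
    have h2 : rabs z * (m z)^-1 <= 1 by rewrite ler_pdivrMr // mul1r.
    have p0 := rabs_ge0 (psi z).
    have -> : r * ((m z)^-1 * (m z)^-1) * (rabs (psi z) * rabs z) =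
      (r * (m z)^-1) * (rabs z * (m z)^-1) * rabs (psi z) by ring.
    have h3 : r * (m z)^-1 * (rabs z * (m z)^-1) <= 1.
      by rewrite mulr_ile1 // mulr_ge0 ?rabs_ge0.
    by rewrite mulr_ile1 // !mulr_ge0 ?rabs_ge0.
  have Bphi : BcSG (unit_calculus phi a).
    by have [cphi _ _] := gphi; exact: (BcSG_unit_calculus hq cphi (z0 _ gphi) Ba).
  have Bpsi : BcSG (unit_calculus psi a) by exact: (BcSG_unit_calculus hq cpsi (z0 _ gpsi) Ba).
  have : rC r *: unit_calculus psi a = conv a (unit_calculus phi a).
    apply: (BcSG_ext hq); [exact: (BcSGZ hq)|exact: (conv_BcSG hq)|].
    move=> v uv; rewrite (conv_BcSG_unit hq) //; last exact: BS.
    rewrite !fctE /GRing.scale /= !(unit_calculusE hq) // /phi.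
    have [le|gt] := leP (rabs (a v)) r; first by rewrite psir // !(mul0r, mulr0).
    have mE : m (a v) = rabs (a v) by rewrite /m; apply/max_idPl/ltW.
    transitivity (rC (r * ((m (a v))^-1 * (m (a v))^-1)) * (a v * (a v)^*) * psi (a v)).
      2: by ring.
    rewrite rabsCK -rCM mE expr2.
    congr (rC _ * _); have : rabs (a v) != 0 by lra.
    by move=> n0; field.
  move=> /(congr1 (fun a => rnorm (iota a))).
  rewrite (iotaZ hA) ?(iotaM hA); try exact: BC.
  rewrite rnormZ rabs_rC gtr0_norm // => h.
  have := rnormM (iota a) (iota (unit_calculus phi a)); rewrite -h -/rho => h'.
  have := IH _ gphi => h''.
  rewrite exprS; have -> : rho / r * (rho / r) ^+ n = (rho * (rho / r) ^+ n) / r by ring.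
  rewrite ler_pdivlMr // mulrC; apply: le_trans h' _.
  by rewrite ler_wpM2l.
pose psi (z : cplx R) : cplx R := rC ((m z - r) * (m z)^-1).
have gpsi : good psi.
  split.
  - have cmr := rcontD cm (@rcont_cst R (cplx R) (- r)).
    exact: (cont_rC (rcontM cmr (rcontV cm m0))).
  - by move=> z zr; rewrite /psi /m (@max_idPr _ _ (rabs z) r _) // subrr mul0r.
  move=> z; rewrite /psi rabs_rC; have mr := m_r z.
  have mp : 0 < m z by lra.
  rewrite ger0_norm; last by rewrite divr_ge0 // ?subr_ge0 // ltW.
  by rewrite ler_pdivrMr // mul1r; lra.
have Bpsi : BcSG (unit_calculus psi a).
  by have [cpsi _ _] := gpsi; exact: (BcSG_unit_calculus hq cpsi (z0 _ gpsi) Ba).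
have le0 : rnorm (iota (unit_calculus psi a)) <= 0.
  apply: (@geometric_le0 _ (rho / r)); last by move=> n; exact: contr.
  by rewrite divr_ge0 ?(ltW r0) //= ltr_pdivrMr // mul1r.
have : unit_calculus psi a = 0.
  apply: iota_eq0; first exact: BC.
  by apply: rnorm_eq0; apply: le_anti; rewrite le0 rnorm_ge0.
move=> /(congr1 (fun b : S -> cplx R => rabs (b u))).
rewrite (unit_calculusE hq) // rabs0 /psi rabs_rC.
have -> : m (a u) = rabs (a u) by rewrite /m; apply/max_idPl/ltW.
move=> /eqP; rewrite normr_eq0 mulf_eq0 invr_eq0 => /orP[]/eqP; lra.
Qed.

(** [n^* n] is in [BcSG], and its values are squares of values of [n]. *)
Lemma NcSG_norm_le_sup n (M : R) : NcSG n -> 0 <= M -> (forall e, rabs (n e) <= M) ->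
  rnorm (iota n) <= M.
Proof.
move=> Nn M0 nM.
have Ns := NcSG_star hq Nn; have Cn := NcSG_CSG Nn.
suff : rnorm (iota n) ^+ 2 <= M ^+ 2.
  by rewrite ler_pXn2r // nnegrE ?rnorm_ge0.
rewrite -NcSG_iota_cstar //; apply: BcSG_norm_le_sup.
- exact: (conv_star_BcSG hq).
- exact: sqr_ge0.
move=> u uu.
have [[f af fe]|none] := pselect (exists2 f, csupp (fstar n) f & grng f = grng u).
  rewrite (conv_NcSGE hq hsigma Ns Cn fe af) rabsM /fstar rabsJ.
  by rewrite expr2 ler_pM // rabs_ge0.
rewrite (conv_no_term hq hsigma) ?rabs0 ?sqr_ge0 // => f /osupp_csupp af fe.
by apply: none; exists f.
Qed.

(** Multiplying by a normalized [b] in [NcSG], with [|b|] equal to 1 at [e^-1],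
    moves the value of [a] at [e] to the unit [gsrc e]; the diagonal map, which is
    contractive, then reduces to the case of [BcSG]. *)
Lemma CcSG_value_le_norm a e : CcSG a -> rabs (a e) <= rnorm (iota a).
Proof.
move=> Ca; have [a0|ane] := eqVneq (rabs (a e)) 0; first by rewrite a0 rnorm_ge0.
have c0 : 0 < rabs (a e) by rewrite lt_def ane rabs_ge0.
set c := rabs (a e) in c0 *.
have [k [ck k01 nk kN]] := bisection_cutoff hq (q (ginv e)).
have Cs := CcSG_star hq Ca.
pose j x := (Num.max x c)^-1.
have mp x : 0 < Num.max x c by rewrite lt_max c0 orbT.
have cj : continuous j.
  have cid : continuous (fun x : R => x) by move=> x; exact: cvg_id.
  apply: (rcontV (rcont_max cid (@rcont_cst R R c))) => x.
  by rewrite gt_eqF.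
(* [a^*] with its values scaled down to modulus at most 1 *)
pose b0 e' := rC (j (rabs (fstar a e'))) * fstar a e'.
have Cb0 : CcSG b0.
  exact: (CcSG_mul hq (T_invariant_norm cj (CcSG_CSG Cs)) Cs).
pose b e' := rC (k (q e')) * b0 e'.
have Nb : NcSG b by exact: kN.
have b1 : rnorm (iota b) <= 1.
  apply: NcSG_norm_le_sup => // e'; rewrite /b /b0 !rabsM !rabs_rC.
  have /andP[k0 k1] := k01 (q e').
  rewrite (ger0_norm k0) ger0_norm; last by rewrite invr_ge0 ltW.
  rewrite mulr_ile1 //; first by rewrite mulr_ge0 ?rabs_ge0 // invr_ge0 ltW.
  by rewrite /j mulrC ler_pdivrMr // mul1r le_max lexx.
have be : rabs (b (ginv e)) = 1.
  rewrite /b /b0 !rabsM !rabs_rC (nbhs_singleton nk) normr1 mul1r.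
  rewrite /fstar ginvK rabsJ -/c /j maxxx ger0_norm ?mulVf ?gt_eqF //.
  by rewrite invr_ge0 ltW.
have Cba : CcSG (conv b a) by exact: (conv_CcSG hq).
have val : rabs (diag q (conv b a) (gsrc e)) = c.
  rewrite diag_unit; last by apply: (q_units hq); exact: units_src.
  rewrite (@conv_NcSGE _ _ _ _ _ hq _ hsigma _ _ _ (ginv e)) //.
  - by rewrite rabsM be mul1r ginvK gmul_src.
  - exact: CcSG_CSG.
  - by rewrite grng_inv grng_src.
  apply: osupp_csupp; rewrite /osupp /=; apply/eqP => b00.
  by move: be; rewrite b00 rabs0 => /esym/eqP; rewrite oner_eq0.
rewrite -val; apply: le_trans (BcSG_value_le_norm (BcSG_diag hq Cba) (units_src e)) _.
apply: le_trans (iota_diag Cba) _.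
rewrite (iotaM hA) //; last exact: (NcSG_CcSG hq).
apply: le_trans (rnormM _ _) _.
rewrite -[leRHS]mul1r ler_wpM2r ?rnorm_ge0 //.
Qed.

End NormEstimates.

(** * Closures in C*-algebras *)

Section CstarClosures.
Context {R : realType} {A : cstarAlgType R}.
Implicit Types (x y : A) (X Y Z : set A).

Lemma rnorm_ballE x y (eps : R) : ball x (rC eps) y = (rnorm (x - y) < eps) :> Prop.
Proof. by rewrite -ball_normE /ball_ /= rnormE rC_lt. Qed.

Lemma closureP X x : closure X x <->
  forall eps : R, 0 < eps -> exists2 y, X y & rnorm (x - y) < eps.
Proof.
split=> [cX eps e0|h V /nbhs_ballP[r /= r0 rV]].
  have e0' : 0 < rC eps by rewrite -rC0 rC_lt.
  have [y [Xy xy]] := cX _ (nbhsx_ballx x _ e0').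
  by exists y => //; rewrite -rnorm_ballE.
have rE : r = rC (reC r) by exact/ge0_rC/ltW.
have r0' : 0 < reC r by rewrite -rC_lt -rE.
have [y Xy xy] := h _ r0'; exists y; split=> //; apply: rV.
by rewrite rE rnorm_ballE.
Qed.

Lemma rnorm_triangle x y z : rnorm (x - z) <= rnorm (x - y) + rnorm (y - z).
Proof. by have := rnormD (x - y) (y - z); rewrite addrA subrK. Qed.

Lemma rnorm_eq x y : (forall eps : R, 0 < eps -> rnorm (x - y) <= eps) -> x = y.
Proof.
move=> h; apply/eqP; rewrite -subr_eq0; apply/eqP/rnorm_eq0.
apply: le_anti; rewrite rnorm_ge0 andbT; apply/ler_addgt0Pr => eps e0.
by rewrite add0r h.
Qed.

Lemma amulBl x y z : amul (x - y) z = amul x z - amul y z.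
Proof. by rewrite amulDl -scaleN1r amulZl scaleN1r. Qed.

Lemma amulBr x y z : amul x (y - z) = amul x y - amul x z.
Proof. by rewrite amulDr -scaleN1r amulZr scaleN1r. Qed.

Lemma astarB x y : astar (x - y) = astar x - astar y.
Proof. by rewrite astarD -scaleN1r astarZ rmorphN1 scaleN1r. Qed.

Lemma amul_near x y (eps : R) : 0 < eps -> exists2 delta : R, 0 < delta &
  forall x' y', rnorm (x - x') < delta -> rnorm (y - y') < delta ->
    rnorm (amul x y - amul x' y') < eps.
Proof.
move=> e0; have x0 := rnorm_ge0 x; have y0 := rnorm_ge0 y.
have s0 : 0 < rnorm x + rnorm y + 1 by lra.
exists (Num.min 1 (eps / (rnorm x + rnorm y + 1))).
  by rewrite lt_min ltr01 divr_gt0.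
move=> x' y'; rewrite !lt_min => /andP[x1 xe] /andP[y1 ye].
have xx0 := rnorm_ge0 (x - x'); have yy0 := rnorm_ge0 (y - y').
move: xe ye; rewrite !ltr_pdivlMr // => xe ye.
have -> : amul x y - amul x' y' = amul (x - x') y + amul x' (y - y').
  by rewrite amulBl amulBr addrA subrK.
apply: le_lt_trans (rnormD _ _) _.
have := rnormM (x - x') y; have := rnormM x' (y - y').
have := rnormB x (x - x'); rewrite opprB addrC subrK.
have := rnorm_ge0 x'.
set p := rnorm (x - x') in x1 xe xx0 *; set r := rnorm (y - y') in y1 ye yy0 *.
move=> h1 h2 h3 h4.
have h5 : rnorm x' * r <= (rnorm x + 1) * r by rewrite ler_wpM2r //; lra.
have [pr|rp] := leP p r; nra.
Qed.

Lemma closure_amul X Y Z x y : closure X x -> closure Y y ->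
  (forall x' y', X x' -> Y y' -> Z (amul x' y')) -> closure Z (amul x y).
Proof.
move=> /closureP cX /closureP cY XYZ; apply/closureP => eps e0.
have [d d0 hd] := amul_near x y e0.
have [x' Xx' xx'] := cX d d0; have [y' Yy' yy'] := cY d d0.
by exists (amul x' y'); [exact: XYZ|exact: hd].
Qed.

Lemma closure_amul_pair Z x y :
  (forall eps : R, 0 < eps -> exists x' y',
     [/\ Z (amul x' y'), rnorm (x - x') < eps & rnorm (y - y') < eps]) ->
  closure Z (amul x y).
Proof.
move=> h; apply/closureP => eps e0.
have [d d0 hd] := amul_near x y e0; have [x' [y' [Zxy xx' yy']]] := h d d0.
by exists (amul x' y') => //; exact: hd.
Qed.

Lemma closure_astar X Y x : closure X x -> (forall x', X x' -> Y (astar x')) ->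
  closure Y (astar x).
Proof.
move=> /closureP cX XY; apply/closureP => eps e0; have [x' Xx' xx'] := cX _ e0.
by exists (astar x'); [exact: XY|rewrite -astarB rnorm_star].
Qed.

Lemma closure_lin X (c : cplx R) x y : closure X x -> closure X y ->
  (forall x' y', X x' -> X y' -> X (c *: x' + y')) -> closure X (c *: x + y).
Proof.
move=> /closureP cX /closureP cY XX; apply/closureP => eps e0.
have c0 := rabs_ge0 c.
have d0 : 0 < eps / (rabs c + 1) by rewrite divr_gt0 //; lra.
have [x' Xx' xx'] := cX _ d0; have [y' Yy' yy'] := cY _ d0.
exists (c *: x' + y'); first exact: XX.
rewrite opprD addrACA -scalerBr; apply: le_lt_trans (rnormD _ _) _; rewrite rnormZ.
move: xx' yy'; rewrite !ltr_pdivlMr; [|lra..].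
have := rnorm_ge0 (x - x'); have := rnorm_ge0 (y - y').
set p := rnorm (x - x'); set r := rnorm (y - y') => p0 r0 h1 h2.
have [pr|rp] := leP p r; nra.
Qed.

Lemma closure_commute X x y : closure X x -> closure X y ->
  (forall x' y', X x' -> X y' -> amul x' y' = amul y' x') -> amul x y = amul y x.
Proof.
move=> /closureP cX /closureP cY XX; apply: rnorm_eq => eps e0.
have e2 : 0 < eps / 2 by rewrite divr_gt0.
have [d1 d10 h1] := amul_near x y e2; have [d2 d20 h2] := amul_near y x e2.
have d0 : 0 < Num.min d1 d2 by rewrite lt_min d10.
have [x' Xx'] := cX _ d0; rewrite lt_min => /andP[x1 x2].
have [y' Xy'] := cY _ d0; rewrite lt_min => /andP[y1 y2].
have := h1 _ _ x1 y1; have := h2 _ _ y2 x2; rewrite (XX x' y') //.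
have := rnorm_triangle (amul x y) (amul y' x') (amul y x).
rewrite (rnormC (amul y' x')); lra.
Qed.

Lemma linear_span_closed X : subspace_closed (linear_span X).
Proof.
split=> [W [[W0 _] _]//|c x y hx hy W hW].
by have [[_ WD] _] := hW; apply: WD; [exact: hx hW|exact: hy hW].
Qed.

Lemma cstar_gen_closed X : cstar_subalgebra (cstar_gen X).
Proof.
split.
- split=> [W [[[W0 _] _ _] _]//|c x y hx hy W hW].
  by have [[[_ WD] _ _] _] := hW; apply: WD; [exact: hx hW|exact: hy hW].
- split=> [m n hm hn W hW|n hn W hW]; have [[_ [hM hS] _] _] := hW.
    by apply: hM; [exact: hm hW|exact: hn hW].
  by apply: hS; exact: hn hW.
by apply: closed_bigI => W [[_ _ cW] _].
Qed.

End CstarClosures.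

(** * The monomial semigroup of the completion *)

Section Completion.
Context {R : realType} {S G : spaceGroupoidType}.
Context {act : cplx R -> S -> S} {q : S -> G} {sigma : G -> S}.
Context {nrm : (S -> cplx R) -> cplx R}.
Context {A : cstarAlgType R} {iota : (S -> cplx R) -> A}.
Hypothesis hq : twist act q.
Hypothesis hsigma : forall g, q (sigma g) = g.
Hypothesis hnrm : cstar_norm act q sigma nrm.
Hypothesis hD : diag_contractive act q nrm.
Hypothesis hA : completion act q sigma nrm iota.
Implicit Types (t : cplx R) (e f u v : S) (a b : S -> cplx R) (x y : A).

Local Notation CSG := (@CSG R S act).
Local Notation CcSG := (@CcSG R S act).
Local Notation NcSG := (@NcSG R S G act q).
Local Notation BcSG := (@BcSG R S G act q).
Local Notation conv := (@conv R S G q sigma).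
Local Notation unit_calculus := (@unit_calculus R S G act q).
Local Notation N := (closure (iota @` NcSG)).
Local Notation B := (closure (iota @` BcSG)).

Let BC a (h : BcSG a) : CcSG a := BcSG_CcSG h.
Let BS a (h : BcSG a) : CSG a := BcSG_CSG h.
Let NS a (h : NcSG a) : CSG a := NcSG_CSG h.
Let NC a (h : NcSG a) : CcSG a := NcSG_CcSG hq h.
Let dC a (h : CcSG a) : CcSG (diag q a) := BC (BcSG_diag hq h).

Lemma iota_closureP (X : set (S -> cplx R)) x : closure (iota @` X) x <->
  forall eps : R, 0 < eps -> exists2 a, X a & rnorm (x - iota a) < eps.
Proof.
rewrite closureP; split=> h eps /h; last by move=> [a Xa xa]; exists (iota a) => //; exists a.
by move=> [_ [a Xa <-] xa]; exists a.
Qed.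

Lemma iota_dense_ex x (eps : R) : 0 < eps -> exists2 a, CcSG a & rnorm (x - iota a) < eps.
Proof.
move=> e0; have : closure (iota @` CcSG) x by rewrite (iota_dense hA).
by move/iota_closureP; apply.
Qed.

Lemma B_sub_N : B `<=` N.
Proof.
by apply: closure_subset => _ [a Ba <-]; exists a => //; exact: (BcSG_NcSG hq).
Qed.

Lemma B_lin (c : cplx R) x y : B x -> B y -> B (c *: x + y).
Proof.
move=> Bx By; apply: closure_lin => // _ _ [a Ba <-] [b Bb <-].
exists (c *: a + b); first exact: (BcSG_lin hq).
by rewrite (iota_lin hq hA) //; exact: BC.
Qed.

Lemma B_iota a : BcSG a -> B (iota a).
Proof. by move=> Ba; apply: subset_closure; exists a. Qed.

Lemma iota_star_mul a b : CcSG a -> CcSG b ->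
  amul (astar (iota a)) (iota b) = iota (conv (fstar a) b).
Proof.
by move=> Ca Cb; rewrite -(iota_star hA) // -(iotaM hA) //; exact: (CcSG_star hq).
Qed.

Lemma iota_mul_star a b : CcSG a -> CcSG b ->
  amul (iota a) (astar (iota b)) = iota (conv a (fstar b)).
Proof.
by move=> Ca Cb; rewrite -(iota_star hA) // -(iotaM hA) //; exact: (CcSG_star hq).
Qed.

Lemma B_subalgebra : cstar_subalgebra B.
Proof.
split; last exact: closed_closure.
  split; last exact: B_lin.
  by rewrite -(iota0 hq hA); apply: B_iota; exact: (BcSG0 hq).
split=> [x y Bx By|x Bx].
  apply: closure_amul Bx By _ => _ _ [a Ba <-] [b Bb <-].
  exists (conv a b); first exact: (conv_BcSG hq).
  by rewrite (iotaM hA) //; exact: BC.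
apply: closure_astar Bx _ => _ [a Ba <-].
exists (fstar a); first exact: (BcSG_star hq).
by rewrite (iota_star hA) //; exact: BC.
Qed.

Lemma B_commutative x y : B x -> B y -> amul x y = amul y x.
Proof.
move=> Bx By; apply: closure_commute Bx By _ => _ _ [a Ba <-] [b Bb <-].
rewrite -!(iotaM hA); try exact: BC.
congr iota; apply: (BcSG_ext hq); try exact: (conv_BcSG hq).
move=> u uu; rewrite !(conv_BcSG_unit hq) //; try exact: BS.
by rewrite mulrC.
Qed.

Lemma N_star_subsemigroup : star_subsemigroup N.
Proof.
split=> [x y Nx Ny|x Nx].
  apply: closure_amul Nx Ny _ => _ _ [a Na <-] [b Nb <-].
  exists (conv a b); first exact: (conv_NcSG hq).
  by rewrite (iotaM hA) //; exact: NC.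
apply: closure_astar Nx _ => _ [a Na <-].
exists (fstar a); first exact: (NcSG_star hq).
by rewrite (iota_star hA) //; exact: NC.
Qed.

Lemma positives_N_sub_B : positives N `<=` B.
Proof.
move=> _ [n Nn <-]; apply: closure_amul_pair => eps e0.
have [a Na na] := (iota_closureP _ _).1 Nn eps e0.
exists (astar (iota a)), (iota a); split=> //; last by rewrite -astarB rnorm_star.
rewrite iota_star_mul; try exact: NC.
by exists (conv (fstar a) a) => //; exact: (conv_star_BcSG hq).
Qed.

(** Products of elements of [BcSG] are combinations of elements [c^* c]. *)
Lemma polarization a b : BcSG a -> BcSG b ->
  let p c := conv (fstar c) c in
  4 *: conv (fstar a) b =
    p (a + b) - p (a - b) - 'i *: (p (a + 'i *: b) - p (a - 'i *: b)).
Proof.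
move=> Ba Bb /=.
have Bp c : BcSG c -> BcSG (conv (fstar c) c).
  by move=> Bc; apply: (conv_star_BcSG hq hsigma); exact: (BcSG_NcSG hq).
have Bi : BcSG ('i *: b) by exact: (BcSGZ hq).
have B1 := BcSGD hq Ba Bb; have B2 := BcSGB hq Ba Bb.
have B3 := BcSGD hq Ba Bi; have B4 := BcSGB hq Ba Bi.
apply: (BcSG_ext hq).
- by apply: (BcSGZ hq); apply: (conv_BcSG hq) => //; exact: (BcSG_star hq).
- apply: (BcSGB hq); last apply: (BcSGZ hq);
  by apply: (BcSGB hq); exact: Bp.
move=> u uu; rewrite !fctE /GRing.scale /= !(conv_star_unit hq hsigma) //; try exact: BS.
rewrite ?fctE /GRing.scale /= !(rmorphD, rmorphN, rmorphM) /= conjCi.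
have i2 : 'i * 'i = -1 :> cplx R by rewrite -expr2 sqrCi.
set x := a u; set y := b u; set x' := x^*; set y' := y^*.
transitivity (2 * (x' * y + y' * x) - ('i * 'i) * (2 * (x' * y - y' * x))); last by ring.
by rewrite i2; ring.
Qed.

(** [B] is generated by the elements [n^* n]: by polarization the generated algebra
    contains the products [x^* y] of elements of [BcSG], and every [b] in [BcSG] is
    a limit of such products. *)
Lemma B_generated (W : set A) : cstar_subalgebra W -> positives N `<=` W -> B `<=` W.
Proof.
move=> [[W0 Wlin] _ Wc] NW.
have WD x y : W x -> W y -> W (x + y).
  by move=> Wx Wy; rewrite -[x]scale1r; exact: Wlin.
have WZ (c : cplx R) x : W x -> W (c *: x).
  by move=> Wx; rewrite -[_ *: _]addr0; exact: Wlin.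
have WB x y : W x -> W y -> W (x - y).
  by move=> Wx Wy; rewrite addrC -scaleN1r; exact: Wlin.
have Wp c : BcSG c -> W (iota (conv (fstar c) c)).
  move=> Bc; apply: NW; exists (iota c); last by rewrite iota_star_mul //; exact: BC.
  by apply: B_sub_N; exact: B_iota.
have Wprod a b : BcSG a -> BcSG b -> W (iota (conv (fstar a) b)).
  move=> Ba Bb.
  have Bp c : BcSG c -> CcSG (conv (fstar c) c).
    by move=> Bc; apply/BC/(conv_star_BcSG hq hsigma)/(BcSG_NcSG hq).
  have Bi : BcSG ('i *: b) by exact: (BcSGZ hq).
  have B1 := BcSGD hq Ba Bb; have B2 := BcSGB hq Ba Bb.
  have B3 := BcSGD hq Ba Bi; have B4 := BcSGB hq Ba Bi.
  have -> : conv (fstar a) b = 4^-1 *: (4 *: conv (fstar a) b).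
    by rewrite scalerA mulVf ?scale1r // pnatr_eq0.
  have Cprod : CcSG (conv (fstar a) b).
    by apply: BC; apply: (conv_BcSG hq) => //; exact: (BcSG_star hq).
  rewrite (iotaZ hA); last exact: (CcSGZ hq).
  apply: (WZ 4^-1); rewrite polarization //.
  rewrite (iotaB hq hA); last first.
  - by apply: (CcSGZ hq); apply: (CcSGB hq); exact: Bp.
  - by apply: (CcSGB hq); exact: Bp.
  rewrite (iotaZ hA); last by apply: (CcSGB hq); exact: Bp.
  rewrite !(iotaB hq hA); try exact: Bp.
  by apply: (WB); [|apply: (WZ 'i)]; apply: (WB); exact: Wp.
suff BW : iota @` BcSG `<=` W.
  by move=> x Bx; apply: Wc; exact: closure_subset BW _ Bx.
move=> _ [b Bb <-]; apply: Wc; apply/closureP => eps e0.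
(* b is the limit of b |b| / (|b| + eps), a product of two elements *)
pose d := eps / 2; have d0 : 0 < d by rewrite divr_gt0.
pose psi (z : cplx R) : cplx R := rC (rabs z * (rabs z + d)^-1).
have cpsi : continuous psi.
  have cd := rcontD (@rabs_continuous R) (@rcont_cst R (cplx R) d).
  apply: (cont_rC (rcontM (@rabs_continuous R) (rcontV cd _))) => z.
  by rewrite gt_eqF // ltr_wpDl // rabs_ge0.
have psi0 : psi 0 = 0 by rewrite /psi rabs0 mul0r.
have Bpsi := BcSG_unit_calculus hq cpsi psi0 Bb.
exists (iota (conv (fstar (unit_calculus psi b)) b)); first exact: Wprod.
have Bp : BcSG (conv (fstar (unit_calculus psi b)) b).
  by apply: (conv_BcSG hq) => //; exact: (BcSG_star hq).
rewrite -(iotaB hq hA); try exact: BC.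
apply: (@le_lt_trans _ _ d); last by rewrite /d; lra.
apply: (BcSG_norm_le_sup hq hsigma hA).
- exact: (BcSGB hq).
- exact: ltW.
move=> u uu; rewrite !fctE (conv_star_unit hq hsigma) //; last exact: BS.
rewrite (unit_calculusE hq) // /psi conj_rC.
set z := b u; have z0 := rabs_ge0 z.
rewrite -{1}[z]mul1r -mulrBl rabsM -rC1 -rCN -rCD rabs_rC.
have zd : 0 < rabs z + d by lra.
have -> : 1 + - (rabs z * (rabs z + d)^-1) = d / (rabs z + d).
  by field; rewrite gt_eqF.
rewrite ger0_norm; last by rewrite divr_ge0 // ltW.
rewrite mulrAC ler_pdivrMr //; nra.
Qed.

Lemma semi_cartan_NE : semi_cartan N = B.
Proof.
apply/seteqP; split.
  by apply: smallest_sub; [exact: B_subalgebra|exact: positives_N_sub_B].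
apply: B_generated; first exact: cstar_gen_closed.
exact: sub_gen_smallest.
Qed.

Lemma N_dense : closure (linear_span N) = [set: A].
Proof.
apply/seteqP; split=> // x _.
have [L0 LD] := linear_span_closed N.
have : closure (iota @` CcSG) x by rewrite (iota_dense hA).
apply: closure_subset => _ [a Ca <-].
have := @CcSG_bisection_ind R S G act q hq
  (fun a => CcSG a -> linear_span N (iota a)) _ _ a Ca Ca.
apply; first by move=> _; rewrite (iota0 hq hA).
move=> n b Nn Cb IH _; rewrite (iotaD hA) //; last exact: NC.
rewrite -[iota n]scale1r; apply: LD; last exact: IH.
by apply: sub_gen_smallest; apply: subset_closure; exists n.
Qed.

(** The closure of the graph of the diagonal map of [CcSG]; it is the graph of the
    expectation. *)
Definition diag_ext_rel x y : Prop := forall eps : R, 0 < eps ->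
  exists a, [/\ CcSG a, rnorm (x - iota a) < eps & rnorm (y - iota (diag q a)) < eps].

Lemma diag_ext_lin (c : cplx R) x y x' y' :
  diag_ext_rel x x' -> diag_ext_rel y y' -> diag_ext_rel (c *: x + y) (c *: x' + y').
Proof.
move=> hx hy eps e0; have c0 := rabs_ge0 c.
have d0 : 0 < eps / (rabs c + 1) by rewrite divr_gt0 //; lra.
have [a [Ca xa xa']] := hx _ d0; have [b [Cb yb yb']] := hy _ d0.
have key (z w z' w' : A) : rnorm (z - z') < eps / (rabs c + 1) ->
    rnorm (w - w') < eps / (rabs c + 1) ->
    rnorm (c *: z + w - (c *: z' + w')) < eps.
  move=> h1 h2; rewrite opprD addrACA -scalerBr.
  apply: le_lt_trans (@rnormD _ A _ _) _; rewrite rnormZ; move: h1 h2.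
  rewrite !ltr_pdivlMr; [|lra..].
  have := @rnorm_ge0 _ A (z - z'); have := @rnorm_ge0 _ A (w - w').
  set p := rnorm (z - z'); set r := rnorm (w - w') => p0 r0 h3 h4.
  have [pr|rp] := leP p r; nra.
exists (c *: a + b); split; first exact: (CcSG_lin hq).
  by rewrite (iota_lin hq hA) //; exact: key.
by rewrite diag_lin (iota_lin hq hA) //; [exact: key|exact: dC|exact: dC].
Qed.

Lemma diag_ext_le x y : diag_ext_rel x y -> rnorm y <= rnorm x.
Proof.
move=> h; apply/ler_addgt0Pr => eps e0.
have e2 : 0 < eps / 2 by rewrite divr_gt0.
have [a [Ca xa ya]] := h _ e2.
have h1 := iota_diag hq hD hA Ca.
have h2 := rnormD (y - iota (diag q a)) (iota (diag q a)); rewrite subrK in h2.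
have h3 := rnormB x (x - iota a); rewrite opprB addrC subrK in h3.
lra.
Qed.

Lemma diag_ext_uniq x y y' : diag_ext_rel x y -> diag_ext_rel x y' -> y = y'.
Proof.
move=> h h'; have := diag_ext_le (diag_ext_lin (-1) h' h).
rewrite !scaleN1r addNr rnorm0 addrC => le0.
apply/eqP; rewrite -subr_eq0; apply/eqP/rnorm_eq0/le_anti.
by rewrite le0 rnorm_ge0.
Qed.

Lemma diag_ext_iota a : CcSG a -> diag_ext_rel (iota a) (iota (diag q a)).
Proof. by move=> Ca eps e0; exists a; rewrite !subrr rnorm0. Qed.

(** The images under the diagonal map of the approximations of [x] form a Cauchy
    filter, by contractivity. *)
Lemma diag_ext_ex x : exists y, diag_ext_rel x y.
Proof.
pose F := filter_from [set eps : R | 0 < eps]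
  (fun eps => [set y | exists a, [/\ CcSG a, rnorm (x - iota a) < eps & y = iota (diag q a)]]).
have FF : ProperFilter F.
  apply: filter_from_proper; last first.
    move=> eps /= e0; have [a Ca xa] := iota_dense_ex x e0.
    by exists (iota (diag q a)), a.
  apply: filter_from_filter; first by exists 1 => /=.
  move=> e1 e2 /= e10 e20; exists (Num.min e1 e2); first by rewrite /= lt_min e10.
  move=> _ [a [Ca + ->]]; rewrite lt_min => /andP[xa1 xa2].
  by split; exists a.
have cF : cauchy F.
  apply: cauchy_exP => r r0.
  have rE : r = rC (reC r) by exact/ge0_rC/ltW.
  have r0' : 0 < reC r by rewrite -rC_lt -rE.
  have r2 : 0 < reC r / 2 by rewrite divr_gt0.
  have [a Ca xa] := iota_dense_ex x r2.
  exists (iota (diag q a)); exists (reC r / 2) => // _ [b [Cb xb ->]].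
  rewrite rE rnorm_ballE -(iotaB hq hA); try exact: dC.
  have -> : diag q a - diag q b = diag q (a - b).
    by rewrite addrC -scaleN1r -diag_lin scaleN1r addrC.
  apply: le_lt_trans (iota_diag hq hD hA (CcSGB hq Ca Cb)) _.
  rewrite (iotaB hq hA) //.
  have := rnorm_triangle (iota a) x (iota b); rewrite (rnormC (iota a) x); lra.
have [y Fy] : exists y : A, F --> y.
  by apply/cvg_ex; exact: (@cauchy_cvg A F FF cF).
exists y => eps e0.
have e0' : 0 < rC eps by rewrite -rC0 rC_lt.
have [d /= d0 hd] := Fy _ (nbhsx_ballx y _ e0').
have m0 : 0 < Num.min d eps by rewrite lt_min d0.
have [a Ca] := iota_dense_ex x m0; rewrite lt_min => /andP[xd xe].
exists a; split=> //; rewrite -rnorm_ballE; apply: hd.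
by exists a.
Qed.

Lemma diag_ext_B x y : diag_ext_rel x y -> B y.
Proof.
move=> h; apply/iota_closureP => eps e0; have [a [Ca _ ya]] := h eps e0.
by exists (diag q a) => //; exact: (BcSG_diag hq).
Qed.

Lemma diag_ext_id x : B x -> diag_ext_rel x x.
Proof.
move=> /iota_closureP Bx eps e0; have [a Ba xa] := Bx eps e0.
by exists a; rewrite (diag_BcSG Ba); split=> //; exact: BC.
Qed.

Lemma N_expectation : exists E : {linear A -> A},
  [/\ expectation E, range E = B & forall n, N n -> B (amul (E n) (astar n))].
Proof.
pose E0 x := projT1 (cid (diag_ext_ex x)).
have E0P x : diag_ext_rel x (E0 x) by exact: (projT2 (cid (diag_ext_ex x))).
have E0lin : linear E0.
  move=> c x y; apply: diag_ext_uniq (E0P _) _.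
  exact: diag_ext_lin.
pose E : {linear A -> A} := HB.pack E0 (GRing.isLinear.Build _ _ _ _ E0 E0lin).
have EB x : B x -> E x = x by move=> Bx; exact: diag_ext_uniq (E0P x) (diag_ext_id Bx).
exists E; split.
- split=> x; first by rewrite EB //; exact: diag_ext_B (E0P x).
  by rewrite !rnormE rC_le; exact: diag_ext_le (E0P x).
- apply/seteqP; split=> [_ [x _ <-]|x Bx]; first exact: diag_ext_B (E0P x).
  by exists x => //; exact: EB.
move=> n Nn; apply: closure_amul_pair => eps e0.
have [a Na na] := (iota_closureP _ _).1 Nn eps e0.
have Ca := NC Na.
exists (iota (diag q a)), (astar (iota a)); split.
- rewrite iota_mul_star //; last exact: dC.
  exists (conv (diag q a) (fstar a)) => //; exact: (conv_diag_star hq).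
- have -> : iota (diag q a) = E (iota a).
    exact: diag_ext_uniq (diag_ext_iota Ca) (E0P _).
  rewrite -raddfB; apply: le_lt_trans na; exact: diag_ext_le (E0P _).
by rewrite -astarB rnorm_star.
Qed.

Lemma N_cartan : cartan_semigroup N.
Proof.
split.
- exact: closed_closure.
- exact: N_star_subsemigroup.
- exact: N_dense.
- by rewrite semi_cartan_NE; exact: B_commutative.
- by rewrite semi_cartan_NE; exact: B_sub_N.
by rewrite semi_cartan_NE; exact: N_expectation.
Qed.

(** * Summability *)

(** [x] does not vanish at [e] when viewed, through its approximations, as a
    function on the twist. *)
Definition nonvanishing x e : Prop := exists2 eta : R, 0 < eta &
  forall a, CcSG a -> rnorm (x - iota a) < eta -> eta <= rabs (a e).

Lemma nonvanishing_approx x a e (delta : R) : CcSG a -> rnorm (x - iota a) < delta ->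
  delta <= rabs (a e) -> nonvanishing x e.
Proof.
move=> Ca xa ae; exists ((delta - rnorm (x - iota a)) / 2).
  by rewrite divr_gt0 // subr_gt0.
move=> b Cb xb.
have := CcSG_value_le_norm hq hsigma hnrm hD hA e (CcSGB hq Ca Cb).
rewrite (iotaB hq hA) // => h1.
have h2 := rnorm_triangle (iota a) x (iota b); rewrite (rnormC (iota a) x) in h2.
have h3 : rabs (a e) <= rabs ((a - b) e) + rabs (b e).
  have := @rnormD _ (cplx R) ((a - b) e) (b e).
  by rewrite !fctE subrK.
by move: h1 h2 h3 xa ae xb; lra.
Qed.

(** The common core of the cases [F x y = x^* y] and [F x y = x y^*], for which
    [g] is [e^-1 e'] and [e e'^-1]: the value of [F x y] at [g] is, up to a phase,
    the product of the nonzero values of [x] at [e] and [y] at [e'], whereas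
    elements of [B] vanish outside the part of the twist over the units. *)
Lemma nonvanishing_mul (f : (S -> cplx R) -> (S -> cplx R) -> S -> cplx R)
    (F : A -> A -> A) x y e e' g :
  N x -> N y -> nonvanishing x e -> nonvanishing y e' ->
  (forall eps : R, 0 < eps -> exists2 d : R, 0 < d & forall x' y',
     rnorm (x - x') < d -> rnorm (y - y') < d -> rnorm (F x y - F x' y') < eps) ->
  (forall a b, NcSG a -> NcSG b -> CcSG (f a b) /\ F (iota a) (iota b) = iota (f a b)) ->
  (forall a b, NcSG a -> NcSG b -> a e != 0 -> rabs (f a b g) = rabs (a e) * rabs (b e')) ->
  B (F x y) -> units (q g).
Proof.
move=> Nx Ny [eta1 eta10 h1] [eta2 eta20 h2] near fC fv BF.
apply: contrapT => nu.
have e12 : 0 < eta1 * eta2 / 2 by rewrite divr_gt0 // mulr_gt0.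
have [d d0 hd] := near _ e12.
have m1 : 0 < Num.min d eta1 by rewrite lt_min d0.
have m2 : 0 < Num.min d eta2 by rewrite lt_min d0.
have [a Na] := (iota_closureP _ _).1 Nx _ m1; rewrite lt_min => /andP[xd xe].
have [b Nb] := (iota_closureP _ _).1 Ny _ m2; rewrite lt_min => /andP[yd ye].
have [c Bc Fc] := (iota_closureP _ _).1 BF _ e12.
have ae := h1 a (NC Na) xe; have be := h2 b (NC Nb) ye.
have [Cf fE] := fC a b Na Nb.
have := CcSG_value_le_norm hq hsigma hnrm hD hA g (CcSGB hq Cf (BC Bc)).
rewrite (iotaB hq hA) //; last exact: BC.
rewrite !fctE (BcSG_out Bc nu) subr0 fv //; last first.
  by apply/eqP => a0; move: ae; rewrite a0 rabs0; lra.
have := hd _ _ xd yd; rewrite fE => lt1.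
have := rnorm_triangle (iota (f a b)) (F x y) (iota c).
rewrite (rnormC (iota (f a b)) (F x y)) => tri val.
have : eta1 * eta2 <= rabs (a e) * rabs (b e') by rewrite ler_pM // ltW.
by move: lt1 tri val Fc; lra.
Qed.

Lemma nonvanishing_rng x y e f : N x -> N y -> nonvanishing x e -> nonvanishing y f ->
  B (amul (astar x) y) -> grng e = grng f -> q e = q f.
Proof.
move=> Nx Ny xe yf Bxy ef.
have c : composable (ginv e) f by rewrite /composable gsrc_inv.
have u : units (q (gmul (ginv e) f)).
  apply: (@nonvanishing_mul (fun a b => conv (fstar a) b)
    (fun x y => amul (astar x) y) x y e f) => //.
  - move=> eps e0; have [d d0 hd] := amul_near (astar x) y e0.
    by exists d => // x' y' h1 h2; apply: hd => //; rewrite -astarB rnorm_star.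
  - move=> a b Na Nb; split; last by rewrite iota_star_mul //; exact: NC.
    by apply: (conv_CcSG hq hsigma); [exact: (NcSG_star hq)|exact: NC].
  move=> a b Na Nb ae; rewrite (conv_star_val hq hsigma Na (NS Nb) (osupp_csupp ae)) //.
  by rewrite rabsM rabsJ.
rewrite (q_mul hq) // (q_inv hq) in u.
have cq : composable (ginv (q e)) (q f) by rewrite -(q_inv hq); exact: (q_composable hq).
by rewrite (ginv_uniq cq u) ginvK.
Qed.

Lemma nonvanishing_src x y e f : N x -> N y -> nonvanishing x e -> nonvanishing y f ->
  B (amul x (astar y)) -> gsrc e = gsrc f -> q e = q f.
Proof.
move=> Nx Ny xe yf Bxy ef.
have c : composable e (ginv f) by rewrite /composable grng_inv.
have u : units (q (gmul e (ginv f))).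
  apply: (@nonvanishing_mul (fun a b => conv a (fstar b))
    (fun x y => amul x (astar y)) x y e f) => //.
  - move=> eps e0; have [d d0 hd] := amul_near x (astar y) e0.
    by exists d => // x' y' h1 h2; apply: hd => //; rewrite -astarB rnorm_star.
  - move=> a b Na Nb; split; last by rewrite iota_mul_star //; exact: NC.
    by apply: (conv_CcSG hq hsigma) => //; apply/(CcSG_star hq)/NC.
  move=> a b Na Nb ae; rewrite (conv_val_star hq hsigma Na (NS Nb) (osupp_csupp ae)) //.
  by rewrite rabsM rabsJ.
rewrite (q_mul hq) // (q_inv hq) in u.
have cq : composable (q e) (ginv (q f)) by rewrite -(q_inv hq); exact: (q_composable hq).
by rewrite -[LHS]ginvK -(ginv_uniq cq u) ginvK.
Qed.

(** Truncation of [n]: its values lose at most [delta] in modulus, and its closed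
    support retreats into the places where [n] is bounded below. *)
Lemma soft_threshold n (delta : R) : NcSG n -> 0 < delta -> exists n',
  [/\ NcSG n', rnorm (iota n - iota n') <= delta &
      csupp n' `<=` [set e | delta <= rabs (n e)]].
Proof.
move=> Nn d0; have [cn _] := NS Nn.
pose m (x : R) := Num.max x delta.
have mp (x : R) : 0 < m x by rewrite lt_max d0 orbT.
have cm : continuous m.
  have cid : continuous (fun x : R => x) by move=> x; exact: cvg_id.
  exact: (rcont_max cid (@rcont_cst R R delta)).
have cV : continuous (fun x : R => (m x)^-1).
  by apply: (rcontV cm) => x; rewrite gt_eqF.
have cj := rcontM (@rcont_cst R R delta) cV.
pose h (x : R) := 1 + - (delta * (m x)^-1).
have ch : continuous h := rcontD (@rcont_cst R R 1) (rcontN cj).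
pose n' e := rC (h (rabs (n e))) * n e.
have Nn' : NcSG n' := NcSG_mul hq (T_invariant_norm ch (NS Nn)) Nn.
have Nd := NcSG_mul hq (T_invariant_norm cj (NS Nn)) Nn.
exists n'; split=> //.
  rewrite -(iotaB hq hA); try exact: NC.
  have -> : n - n' = fun e => rC (delta * (m (rabs (n e)))^-1) * n e.
    apply/funext => e; rewrite !fctE /n' /h -{1}[n e]mul1r -mulrBl.
    by rewrite -rC1 -rCN -rCD opprD opprK addrA subrr add0r.
  apply: (NcSG_norm_le_sup hq hsigma hA) => //; first exact: ltW.
  move=> e; rewrite rabsM rabs_rC; set x := rabs (n e); have x0 : 0 <= x := rabs_ge0 _.
  have mx := mp x; rewrite ger0_norm; last by rewrite divr_ge0 // ltW.
  by rewrite mulrAC ler_pdivrMr // ler_wpM2l ?(ltW d0) // /m le_max lexx.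
have cl : closed [set e | delta <= rabs (n e)].
  have /continuous_closedP cc := cont_rabs cn.
  exact: (cc _ (@closed_ge R delta)).
rewrite /csupp [X in _ `<=` X](proj1 (closure_id _) cl); apply: closure_subset => e.
rewrite /osupp /= /n' mulf_eq0 negb_or => /andP[+ _].
rewrite leNgt; apply: contra_neqN => lt.
rewrite /h /m (@max_idPr _ _ (rabs (n e)) delta _) ?ltW //.
by rewrite divff ?gt_eqF // subrr.
Qed.

(** Approximations of [x] and [y], once truncated, have supports on which [x] and
    [y] do not vanish. As [x^* y] and [x y^*] are in [B], such points with the same
    range or source have the same image in [G]: the union of the two supports is
    mapped to a bisection, so the sum of the approximations is in [NcSG]. *)
Lemma N_summable : summable_semigroup N.
Proof.
move=> x y Nx Ny; rewrite semi_cartan_NE => Bl Br.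
apply/iota_closureP => eps e0.
pose d := eps / 4; have d0 : 0 < d by rewrite divr_gt0.
have [m Nm xm] := (iota_closureP _ _).1 Nx _ d0.
have [n Nn yn] := (iota_closureP _ _).1 Ny _ d0.
have [m' [Nm' mm' sm]] := soft_threshold Nm d0.
have [n' [Nn' nn' sn]] := soft_threshold Nn d0.
exists (m' + n'); last first.
  rewrite (iotaD hA); try exact: NC.
  rewrite opprD addrACA; apply: le_lt_trans (rnormD _ _) _.
  have := rnorm_triangle x (iota m) (iota m'); have := rnorm_triangle y (iota n) (iota n').
  by move: xm yn mm' nn'; rewrite /d; lra.
have xv e : csupp m' e -> nonvanishing x e.
  by move=> /sm; exact: nonvanishing_approx (NC Nm) xm.
have yv e : csupp n' e -> nonvanishing y e.
  by move=> /sn; exact: nonvanishing_approx (NC Nn) yn.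
have C' : CcSG (m' + n') by apply: (CcSGD hq); exact: NC.
apply: (@NcSGP _ _ _ _ _ hq _ (csupp m' `|` csupp n')).
- exact: CcSG_CSG C'.
- by apply: compactU; exact: (NcSG_compact hq).
- rewrite -[m']scale1r; apply: subset_trans (@osupp_lin _ _ _ _ _) _.
  by rewrite scale1r; apply: setUSS; exact: osupp_csupp.
apply/bisectionP; split=> _ _ [e es <-] [f fs <-].
  move=> /(q_src_inj hq); case: es fs => es [] fs ef.
  - exact: (NcSG_src_uniq hq Nm').
  - exact: nonvanishing_src Nx Ny (xv _ es) (yv _ fs) Br ef.
  - exact/esym/(nonvanishing_src Nx Ny (xv _ fs) (yv _ es) Br (esym ef)).
  - exact: (NcSG_src_uniq hq Nn').
move=> /(q_rng_inj hq); case: es fs => es [] fs ef.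
- exact: (NcSG_rng_uniq hq Nm').
- exact: nonvanishing_rng Nx Ny (xv _ es) (yv _ fs) Bl ef.
- exact/esym/(nonvanishing_rng Nx Ny (xv _ fs) (yv _ es) Bl (esym ef)).
- exact: (NcSG_rng_uniq hq Nn').
Qed.

End Completion.

Theorem proposition3p3 (R : realType) (S G : spaceGroupoidType)
    (act : cplx R -> S -> S) (q : S -> G) (sigma : G -> S)
    (nrm : (S -> cplx R) -> cplx R)
    (A : cstarAlgType R) (iota : (S -> cplx R) -> A)
    (hq : twist act q)
    (hsigma : forall g, q (sigma g) = g)
    (hnrm : cstar_norm act q sigma nrm)
    (hD : diag_contractive act q nrm)
    (hA : completion act q sigma nrm iota) :
  let N := closure (iota @` NcSG act q) in
  let B := closure (iota @` BcSG act q) in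
  [/\ cartan_semigroup N, summable_semigroup N & semi_cartan N = B].
Proof.
move=> N B; split.
- exact: (N_cartan hq hsigma hD hA).
- exact: (N_summable hq hsigma hnrm hD hA).
exact: (semi_cartan_NE hq hsigma hA).
Qed.
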